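(* Let $\mathcal{G}=(X,E)$ be a finite graph with conductances $(C_{x,y})$ and killing measure $\kappa$ such that the energy $\mathcal{E}$ is positive definite. Let $P$ be the associated transition matrix, and for $\alpha>0$ let $N^{(\alpha)}=(N^{(\alpha)}_{x,y})_{x,y\in X}$ be the matrix of jumping numbers of the Poissonian loop ensemble $\mathcal{L}_\alpha$ of intensity $\alpha\mu$. Write $N=N^{(1)}$. (i) For any Eulerian network $k$, $$\mathbb{P}(N^{(\alpha)}=k)=C_\alpha(k)\,\det(I-P)^{\alpha}\prod_{x,y}P_{x,y}^{k_{x,y}},$$ where $C_\alpha(k)$ is the coefficient of $\prod_{x,y}P_{x,y}^{k_{x,y}}$ in $\mathrm{Per}_\alpha\big(P(k_x,\,x\in X)\big)$. Here $P(k_x,\,x\in X)$ denotes the $|k|\times|k|$ matrix obtained by repeating $k_x$ times each column of $P$ of index $x$ and then $k_y$ times each row of index $y$, with $|k|=\sum_x k_x$. (ii) For $\alpha=1$ there is a simpler expression: for any Eulerian network $k$, $$\mathbb{P}(N=k)=\det(I-P)\,\frac{\prod_{x}k_x!}{\prod_{x,y}k_{x,y}!}\,\prod_{x,y}P_{x,y}^{k_{x,y}}.$$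
   Context: **Graph, energy and transition matrix.** $\mathcal{G}=(X,E)$ is a finite graph without self-loops, with symmetric conductances $C_{x,y}=C_{y,x}\ge 0$ indexed by the edges ($C_{x,y}=0$ if $\{x,y\}\notin E$, in particular $C_{x,x}=0$) and a killing measure $\kappa_x\ge 0$ on $X$. The energy $$\mathcal{E}(f,f)=\frac12\sum_{x,y}C_{x,y}(f(x)-f(y))^2+\sum_x\kappa_x f(x)^2$$ is assumed to be positive definite (transience). Put $\lambda_x=\sum_y C_{x,y}+\kappa_x$ and $P_{x,y}=C_{x,y}/\lambda_x$. The matrix $P$ is a submarkovian transition matrix; the associated chain is absorbed at a cemetery point when killed. **Loops and jumping numbers.** The associated continuous-time Markov process has independent exponential holding times of mean $1$ before each jump, and $\mu$ denotes its loop measure. Only the discrete skeleton of $\mu$ on non-trivial loops (loops with at least two jumps) matters here. A based discrete loop of length $p\ge2$ is a sequence $(\xi_1,\dots,\xi_p)$ of vertices, regarded as a closed path $\xi_1\to\xi_2\to\cdots\to\xi_p\to\xi_1$. A discrete loop is an equivalence class of based loops under cyclic shift. The $\mu$-measure of a non-trivial discrete loop is the product of the transition probabilities $P_{\xi_1,\xi_2}P_{\xi_2,\xi_3}\cdots P_{\xi_p,\xi_1}$ divided by the multiplicity of the loop (the largest $m$ such that the loop is the $m$-fold repetition of a shorter loop). One-point loops make no jumps and contribute nothing to the jumping numbers. $\mathcal{L}_\alpha$ is the Poisson point process of loops with intensity $\alpha\mu$. For $x\ne y$, $N^{(\alpha)}_{x,y}$ is the total number of jumps from $x$ to $y$ (including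 the closing jump of each loop) made by all loops of $\mathcal{L}_\alpha$; $N^{(\alpha)}_{x,x}=0$. **Eulerian networks.** A network is a matrix $k=(k_{x,y})_{x,y\in X}$ with entries in $\mathbb{N}=\{0,1,2,\dots\}$ that vanishes on the diagonal and at every $(x,y)$ such that $\{x,y\}\notin E$. It is Eulerian if $\sum_y k_{x,y}=\sum_y k_{y,x}$ for every $x\in X$; this common value is denoted $k_x$. The convention $0^0=1$ is used. **$\alpha$-permanents.** For an $n\times n$ matrix $A$, $\mathrm{Per}_\alpha(A)=\sum_{\sigma\in S_n}\alpha^{c(\sigma)}\prod_{i=1}^nA_{i,\sigma(i)}$, where $c(\sigma)$ is the number of cycles of $\sigma$; the value for the empty matrix is $1$. In $P(k_x,\,x\in X)$ the repeated rows and columns are listed in the same order, and indices with $k_x=0$ are deleted. The coefficient of $\prod_{x,y}P_{x,y}^{k_{x,y}}$ is taken in $\mathrm{Per}_\alpha(P(k_x,\,x\in X))$ viewed as a polynomial in the entries $P_{x,y}$, one formal variable for each ordered pair $(x,y)$ with $\{x,y\}\in E$.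
   Formalization: In (i) the coefficient C_α(k) is divided by ∏_x k_x!; without this factor (i) is false and contradicts (ii): for one edge {a,b}, k_ab = k_ba = 2, α = 1, the literal coefficient is 4 but (ii) gives 1. *)

(* Defs.v *)
From HB Require Import structures.
From mathcomp Require Import all_boot all_order all_algebra perm.
From mathcomp Require Import all_classical all_reals all_analysis.
From mathcomp Require mpoly.
Import (canonicals, coercions) mpoly.

Set Implicit Arguments.
Unset Strict Implicit.
Unset Printing Implicit Defensive.

Import Order.TTheory GRing.Theory Num.Theory.

Local Open Scope classical_set_scope.
Local Open Scope ring_scope.

Section Transition.
Context {R : realType} {X : finType}.
Implicit Types (C : X -> X -> R) (kappa : X -> R).

Definition energy C kappa (f : X -> R) : R :=
  2^-1 * (\sum_x \sum_y C x y * (f x - f y) ^+ 2)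
  + \sum_x kappa x * f x ^+ 2.

Definition positive_definite_energy C kappa : Prop :=
  forall f : X -> R, (exists x, f x != 0) -> 0 < energy C kappa f.

Definition lambda C kappa (x : X) : R := \sum_y C x y + kappa x.

Definition transition C kappa (x y : X) : R := C x y / lambda C kappa x.

Definition mx_of (A : X -> X -> R) : 'M[R]_#|X| :=
  \matrix_(i, j) A (enum_val i) (enum_val j).

End Transition.

(* The steps of the closed path s_1 -> s_2 -> ... -> s_p -> s_1, closing step
   included. *)
Definition steps (T : Type) (s : seq T) : seq (T * T) := zip s (rot 1 s).

Definition jumps (T : eqType) (s : seq T) (x y : T) : nat :=
  count_mem (x, y) (steps s).

(* [repeats s m] holds when s is the m-fold repetition of some sequence. *)
Definition repeats (T : finType) (s : seq T) (m : nat) : bool :=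
  [exists t : (size s %/ m).-tuple T, s == flatten (nseq m (val t))].

Definition multiplicity (T : finType) (s : seq T) : nat :=
  \max_(m < (size s).+1 | repeats s m) m.

Definition rotation (T : eqType) (s t : seq T) : bool :=
  [exists i : 'I_(size s).+1, t == rot i s].

Lemma rotationP (T : eqType) (s t : seq T) :
  reflect (exists i, t = rot i s) (rotation s t).
Proof.
apply: (iffP existsP) => [[i /eqP ->]|[i ->]]; first by exists i.
exists (inord (minn i (size s))); rewrite inordK ?ltnS ?geq_minr//.
by rewrite -rot_minn.
Qed.

Lemma rotation_refl (T : eqType) : reflexive (@rotation T).
Proof. by move=> s; apply/rotationP; exists 0%N; rewrite rot0. Qed.

Lemma rotation_sym (T : eqType) : symmetric (@rotation T).
Proof.
suff sub s t : @rotation T s t -> rotation t s.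
  by move=> s t; apply/idP/idP; exact: sub.
move=> /rotationP[i ->]; apply/rotationP; exists (size s - i)%N.
by rewrite -[X in (X - i)%N](size_rot i s) -/(rotr i (rot i s)) rotK.
Qed.

Lemma rotation_trans (T : eqType) : transitive (@rotation T).
Proof.
move=> t s u /rotationP[i ->] /rotationP[j ->].
by apply/rotationP; rewrite rot_rot_add; eexists.
Qed.

Lemma rotation_ind (T : eqType) (Q : seq T -> Prop) :
  (forall s, Q s -> Q (rot 1 s)) -> forall s t, rotation s t -> Q s -> Q t.
Proof.
move=> Q1 s _ /rotationP[i ->] Qs; rewrite rot_minn.
have := geq_minr i (size s); elim: (minn _ _) => [|j IHj] js.
  by rewrite rot0.
by rewrite rotS//; apply/Q1/IHj/ltnW.
Qed.

Lemma steps_rot1 (T : Type) (s : seq T) : steps (rot 1 s) = rot 1 (steps s).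
Proof.
case: s => // x [|y s]//.
rewrite /steps rot1_cons [rcons _ _]/= [zip (x :: _) _]/= !rot1_cons.
by rewrite -zip_rcons //= size_rcons.
Qed.

Lemma perm_steps (T : eqType) (s t : seq T) :
  rotation s t -> perm_eq (steps t) (steps s).
Proof.
move=> st.
apply: (rotation_ind (Q := fun u => perm_eq (steps u) (steps s)) _ st) => // u.
by rewrite steps_rot1 perm_rot.
Qed.

Lemma repeats_rot1 (T : finType) (s : seq T) m :
  repeats s m -> repeats (rot 1 s) m.
Proof.
rewrite /repeats size_rot => /existsP[t /eqP st]; apply/existsP.
exists [tuple of rot 1 t]; apply/eqP; rewrite {1}st /=; move: (val t) => {t st}.
case=> [|x u]; first by elim: m.
rewrite [in RHS]rot1_cons; case: m => [|m]//=; rewrite rot1_cons -cats1.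
rewrite -catA cat_rcons; congr cat.
by elim: m => //= m IHm; rewrite -catA IHm cat_rcons.
Qed.

Lemma multiplicity_rotation (T : finType) (s t : seq T) :
  rotation s t -> multiplicity t = multiplicity s.
Proof.
have rep (u v : seq T) m : rotation u v -> repeats u m -> repeats v m.
  move=> uv; apply: (rotation_ind (Q := fun w => repeats w m) _ uv) => w.
  exact: repeats_rot1.
move=> st; have sz : size t = size s.
  by case/rotationP: st => i ->; rewrite size_rot.
rewrite /multiplicity sz; apply: eq_bigl => m; apply/idP/idP; apply: rep => //.
by rewrite rotation_sym.
Qed.

Section Loops.
Context {X : finType}.

Definition based_loop := {s : seq X | (2 <= size s)%N}.

Definition same_loop (s t : based_loop) : bool := rotation (val s) (val t).

Lemma same_loop_refl : reflexive same_loop.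
Proof. by move=> s; exact: rotation_refl. Qed.

Lemma same_loop_sym : symmetric same_loop.
Proof. by move=> s t; exact: rotation_sym. Qed.

Lemma same_loop_trans : transitive same_loop.
Proof. by move=> t s u; exact: rotation_trans. Qed.

Canonical same_loop_equiv :=
  EquivRel same_loop same_loop_refl same_loop_sym same_loop_trans.

Definition loop := {eq_quot same_loop_equiv}%qT.

Definition loop_jumps (l : loop) : X -> X -> nat := jumps (val (repr l)).

Context {R : realType}.
Implicit Type P : X -> X -> R.

Definition based_weight P (s : seq X) : R :=
  (\prod_(p <- steps s) P p.1 p.2) / (multiplicity s)%:R.

Definition loop_weight P (l : loop) : R := based_weight P (val (repr l)).

(* Only the skeleton on loops with at least two jumps: one-point loops make no
   jump, and holding times play no role for the jumping numbers. *)
Definition loop_measure P (A : set loop) : \bar R :=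
  \esum_(l in A) (loop_weight P l)%:E.

(* The two functions of [repr l] above depend only on the loop. *)
Lemma rotation_repr (s : based_loop) :
  rotation (val s) (val (repr (\pi_loop s)%qT)).
Proof.
have /eqmodP : (s = repr (\pi_loop s) %[mod_eq same_loop_equiv])%qT.
  by rewrite reprK.
by [].
Qed.

Lemma loop_jumps_pi (s : based_loop) x y :
  loop_jumps (\pi_loop s)%qT x y = jumps (val s) x y.
Proof. exact/seq.permP/perm_steps/rotation_repr. Qed.

Lemma loop_weight_pi P (s : based_loop) :
  loop_weight P (\pi_loop s)%qT = based_weight P (val s).
Proof.
rewrite /loop_weight /based_weight (multiplicity_rotation (rotation_repr s)).
by rewrite (perm_big _ (perm_steps (rotation_repr s))).
Qed.

End Loops.
Arguments loop : clear implicits.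

Section Poisson.
Context {R : realType} {d : measure_display} {Omega : measurableType d}.
Context {Pr : probability Omega R} {I : choiceType}.
Local Open Scope ereal_scope.

(* A random multiset of points of I is given by the multiplicities L i; this is
   the number of its points lying in A. *)
Definition npoints (L : I -> {RV Pr >-> nat}) (A : set I) (w : Omega) : \bar R :=
  \esum_(i in A) (L i w)%:R%:E.

(* [poisson_prob] has an unused argument of type nat, here 0; it is the Dirac
   mass at 0 when the rate is 0, unlike [poisson_pmf]. *)
Definition poisson_process (nu : set I -> \bar R) (L : I -> {RV Pr >-> nat}) :=
  (forall A : set I, nu A < +oo -> forall n : nat,
     Pr [set w | npoints L A w = n%:R%:E]
     = poisson_prob (fine (nu A)) 0%N [set n]) /\
  (forall (m : nat) (A : 'I_m -> set I), trivIset setT A ->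
     (forall i, nu (A i) < +oo) -> forall n : 'I_m -> nat,
     Pr (\bigcap_i [set w | npoints L (A i) w = (n i)%:R%:E])
     = \prod_(i < m) Pr [set w | npoints L (A i) w = (n i)%:R%:E]).

End Poisson.

Section Jumping.
Context {R : realType} {d : measure_display} {Omega : measurableType d}.
Context {Pr : probability Omega R} {X : finType}.

Definition loop_ensemble (P : X -> X -> R) (alpha : R)
    (L : loop X -> {RV Pr >-> nat}) : Prop :=
  poisson_process (fun A => alpha%:E * loop_measure P A)%E L.

(* \bar R-valued since the sum over the loops is finite only almost surely. *)
Definition jumping_number (L : loop X -> {RV Pr >-> nat}) (x y : X) (w : Omega)
    : \bar R :=
  if x == y then 0%E
  else (\esum_(l in [set: loop X]) (L l w * loop_jumps l x y)%:R%:E)%E.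

End Jumping.

Section Networks.
Context {X : finType}.
Implicit Types (e : rel X) (k : X -> X -> nat).

Definition network e k : Prop := forall x y, x = y \/ ~~ e x y -> k x y = 0%N.

Definition outdeg k (x : X) : nat := (\sum_y k x y)%N.

Definition eulerian e k : Prop :=
  network e k /\ forall x, outdeg k x = (\sum_y k y x)%N.

End Networks.

Definition alpha_per (S : comNzRingType) (a : S) n (A : 'M[S]_n) : S :=
  \sum_(s : 'S_n) a ^+ #|porbits s| * \prod_i A i (s i).

Section Coefficient.
Context {X : finType}.

(* The index x listed m x times, for each x: the common list of the rows and of
   the columns of A(m_x, x in X). *)
Definition repeated (m : X -> nat) : seq X :=
  flatten [seq nseq (m x) x | x <- enum X].

Definition repeat_mx (S : Type) (A : X -> X -> S) (m : X -> nat)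
    : 'M[S]_(size (repeated m)) :=
  \matrix_(i, j) A (tnth (in_tuple (repeated m)) i)
                   (tnth (in_tuple (repeated m)) j).

Definition oriented_edge (e : rel X) := {p : X * X | e p.1 p.2}.

Context (R : realType) (e : rel X).

(* Multivariate polynomials over R in the variables P_(x,y), one for each
   oriented edge (x,y). *)
Definition edge_poly := mpoly.mpoly #|{: oriented_edge e}| R.

Definition formal_transition (x y : X) : edge_poly :=
  if insub (x, y) is Some p
  then mpoly.mpolyX R (mpoly.mnm1 (enum_rank (p : oriented_edge e))) else 0.

Definition edge_monomial (k : X -> X -> nat)
    : mpoly.multinom #|{: oriented_edge e}| :=
  mpoly.Multinom [tuple (let p := val (enum_val i) in k p.1 p.2)
                 | i < #|{: oriented_edge e}|].

(* By the alpha-extension of MacMahon's master theorem (Vere-Jones), the part of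
   degree m_x in each row x of det(1 - P)^(-alpha) is
   Per_alpha(P(m_x, x in X)) / \prod_x m_x!, so this coefficient has to be divided
   by \prod_x (outdeg k x)! to give a probability weight. *)
Definition per_coef (alpha : R) (k : X -> X -> nat) : R :=
  mpoly.mcoeff (edge_monomial k)
    (alpha_per (mpoly.mpolyC _ alpha : edge_poly)
       (repeat_mx formal_transition (outdeg k))).

End Coefficient.

(* Main.v *)
Require Import Defs.
From HB Require Import structures.
From mathcomp Require Import fingroup perm.
From mathcomp Require Import all_boot all_order all_algebra.
From mathcomp Require Import reals.
From mathcomp Require mpoly.
Import (canonicals, coercions) mpoly.
From mathcomp Require Import zify ring lra.

Set Implicit Arguments.
Unset Strict Implicit.
Unset Printing Implicit Defensive.

Import Order.TTheory GRing.Theory Num.Theory.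

Local Open Scope ring_scope.

(** Why the theorem holds.

    The numbers of occurrences of the loops are independent Poisson variables.
    Hence the probability that the jumps of all loops add up to [k] is
    [exp (- alpha mu(all loops))] times the sum, over the finite configurations
    of loops with flow [k], of the products of [(alpha mu(l)) ^ n / n!], where
    [n] is the number of copies of the loop [l]. Each [mu(l)] is a product of
    transition probabilities divided by the multiplicity of [l]; the transition
    probabilities multiply to the monomial of [k] in every configuration
    ([prob_jumping_network]). Two quantities are left to compute.

    The total mass is [sum_p tr (P ^ p) / p = - log det (1 - P)]. Positive
    definiteness of the energy gives a function [h >= 1] with [P h <= r h] and
    [r < 1] ([superharmonic]), so that the traces decay geometrically; and
    [exp (sum_p t ^ p tr (P ^ p) / p) * det (1 - t P)] is constant on [[0, 1]]
    by the Jacobi formula for the derivative of a determinant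
    ([det_exp_trace]).

    The sum [Z k] over configurations, with [alpha / multiplicity] in place of
    [alpha mu(l)], is compared with the sum of [alpha ^ (number of cycles)] over
    the permutations of [|k|] points, [k_x] of them of type [x], that have
    [k_(x,y)] arcs from the type [x] to the type [y]: this is the coefficient of
    the alpha-permanent. Marking a visit to [x] and removing the loop that makes
    it gives
      [k_x Z k = alpha sum_w Z (k - steps of w)],
    where [w] runs over the closed walks from [x] ([config_sum_walk]). Removing
    the cycle through a point of type [x] gives the same recursion for
    permutations, up to the product of the factorials [k_x!] that counts the
    labellings of the points ([cycle_sumE]). So the coefficient is [Z k] times
    this product ([per_coef_loops]).

    When [alpha = 1], the cycles do not matter and the permutations with given
    arcs are counted by multinomial coefficients ([arrangementsE]): there are
    [prod_x (k_x!) ^ 2 / prod_(x,y) k_(x,y)!] of them. *)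

(** * Permutations and removal of a point *)

Section Peel.
Context {T : finType}.
Implicit Types (A : {set T}) (s : {perm T}).

(** Multiplying by [tperm i j] inserts [i] just before [j] in the cycle of [j];
    as [tperm i j] is an involution, each permutation sending [i] to [j] comes
    in this way from exactly one permutation fixing [i]. *)
Lemma perm_on_peel A i j s : i \in A -> j \in A ->
  perm_on (A :\ i) s =
  perm_on A (s * tperm i j)%g && ((s * tperm i j)%g i == j).
Proof.
move=> iA jA; apply/idP/andP => [sA|[sA /eqP sij]].
  have si : s i = i by rewrite (out_perm sA)// !inE eqxx.
  split; last by rewrite permM si tpermL.
  apply: perm_onM; last first.
    apply/fintype.subsetP => a; rewrite inE; by case: tpermP => [->|->|]//; rewrite eqxx.
  by apply: fintype.subset_trans sA _; exact: finset.subsetDl.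
have si : s i = i.
  move: sij; rewrite permM -[RHS](tpermK i j) => /(canRL (tpermK i j)) ->.
  by rewrite tpermK tpermR.
apply/fintype.subsetP => a; rewrite !inE => sa.
rewrite (contraNneq _ sa) => [|->]; last by rewrite si.
apply/negPn/negP => aA; move/negP: sa; apply; apply/eqP.
have := out_perm sA aA; rewrite permM => /(canRL (tpermK i j)) ->.
by apply: tpermD; apply: contraNneq aA => <-.
Qed.

Lemma sum_perm_on_peel (R : nmodType) A i (F : {perm T} -> R) : i \in A ->
  \sum_(s | perm_on A s) F s =
  \sum_(j in A) \sum_(s | perm_on (A :\ i) s) F (s * tperm i j)%g.
Proof.
move=> iA; rewrite (partition_big (fun s : {perm T} => s i) (mem A)) /=; last first.
  by move=> s sA; rewrite perm_closed.
apply: eq_bigr => j jA.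
rewrite (reindex_inj (mulIg (tperm i j))) /=.
by apply: eq_bigl => s; rewrite -perm_on_peel.
Qed.

(** Inserting the fixed point [i] into the cycle of [j] merges two cycles. *)
Lemma porbits_peel A i j s : i \notin A -> perm_on A s -> j != i ->
  #|porbits (s * tperm i j)%g|.+1 = #|porbits s|.
Proof.
move=> iA sA ji; rewrite -porbitsV invMg tpermV -(porbitsV s).
have si : (s^-1 i = i)%g by rewrite -{1}(out_perm sA iA) permK.
have := porbits_mul_tperm s^-1%g i j.
have -> : (i \notin porbit s^-1%g j).
  apply/negP => /porbitP[n ni]; move/eqP: ji; apply.
  have : (s^-1 ^+ n)%g i = i by elim: n {ni} => [|n IHn]; rewrite ?perm1// expgSr permM IHn.
  by rewrite [RHS]ni => /perm_inj.
by rewrite eq_sym ji /= addn1 addn2 => -[].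
Qed.

End Peel.

(** * Flows and walks *)

Section Walks.
Context {X : finType}.

(** The values are integers so that steps can be subtracted freely: the sums
    over configurations and over permutations vanish on a flow with a negative
    value, which spares all conditions of availability. *)
Definition flow := {ffun X * X -> int}.

Definition unit_flow (p : X * X) : flow := [ffun q => (q == p)%:Z].

Definition flow_of (l : seq (X * X)) : flow := \sum_(p <- l) unit_flow p.

Definition outflow (k : flow) (x : X) : int := \sum_y k (x, y).

Definition flow_total (k : flow) : int := \sum_p k p.

Lemma outflowD k k' x : outflow (k + k') x = outflow k x + outflow k' x.
Proof. by rewrite /outflow -big_split; apply: eq_bigr => y _; rewrite !ffunE. Qed.

Lemma outflowB k k' x : outflow (k - k') x = outflow k x - outflow k' x.
Proof. by rewrite /outflow -sumrB; apply: eq_bigr => y _; rewrite !ffunE. Qed.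

Lemma outflow_unit p x : outflow (unit_flow p) x = (x == p.1)%:Z.
Proof.
case: p => a b; rewrite /outflow (bigD1 b)//= big1 ?addr0 => [|y yb].
  by rewrite ffunE xpair_eqE eqxx andbT.
by rewrite ffunE xpair_eqE (negPf yb) andbF.
Qed.

Lemma flow_totalB k k' : flow_total (k - k') = flow_total k - flow_total k'.
Proof. by rewrite /flow_total -sumrB; apply: eq_bigr => y _; rewrite !ffunE. Qed.

Lemma flow_total_outflow k : flow_total k = \sum_x outflow k x.
Proof. by rewrite /flow_total /outflow pair_big; apply: eq_bigr => -[]. Qed.

Lemma flow_total_unit p : flow_total (unit_flow p) = 1.
Proof.
rewrite /flow_total (bigD1 p)//= big1 ?addr0 ?ffunE ?eqxx// => q /negPf qp.
by rewrite ffunE qp.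
Qed.

Lemma flow_of_cons p l : flow_of (p :: l) = unit_flow p + flow_of l.
Proof. exact: big_cons. Qed.

Lemma flow_of_count l p : flow_of l p = (count_mem p l)%:Z.
Proof.
elim: l => [|q l IHl]; first by rewrite /flow_of big_nil ffunE.
by rewrite flow_of_cons !ffunE IHl /= eq_sym -PoszD.
Qed.

Definition walk_steps (y : X) (s : seq X) (c : X) : seq (X * X) :=
  zip (y :: s) (rcons s c).

Lemma steps_cons x s : steps (x :: s) = walk_steps x s x.
Proof. by rewrite /steps rot1_cons. Qed.

(** Hence subtracting a walk from a flow without outflow at its origin makes
    this outflow negative. *)
Lemma outflow_walk y s c : 0 < outflow (flow_of (walk_steps y s c)) y.
Proof.
have flow_ge0 l : 0 <= outflow (flow_of l) y.
  by apply: sumr_ge0 => z _; rewrite flow_of_count.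
case: s => [|z s]; rewrite /walk_steps /= flow_of_cons outflowD outflow_unit /=;
  by rewrite eqxx ltr_wpDr.
Qed.

Lemma big_tupleS (R : nmodType) (T : finType) n (F : seq T -> R) :
  \sum_(s : n.+1.-tuple T) F s = \sum_z \sum_(s : n.-tuple T) F (z :: s).
Proof.
rewrite pair_big /= (reindex (fun p : T * n.-tuple T => cons_tuple p.1 p.2)) /=.
  by [].
exists (fun s => (thead s, [tuple of behead s])) => [[z s]|s] _ //=.
  by rewrite theadE; congr pair; apply/val_inj.
by apply: val_inj; rewrite /= [s in RHS]tuple_eta.
Qed.

End Walks.
Arguments flow : clear implicits.

(** * Permutations weighted by their cycles *)

Lemma addr_eql (V : zmodType) (u v w : V) : (u + v == w) = (v == w - u).
Proof. by rewrite -(inj_eq (addIr (- u)) (u + v)) addrAC subrr add0r. Qed.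

Section AlphaPermanent.
Context {R : fieldType} {X T : finType} (alpha : R) (tau : T -> X).
Implicit Types (A : {set T}) (s : {perm T}) (k : flow X).

Definition arcs A s : flow X := \sum_(a in A) unit_flow (tau a, tau (s a)).

(** The arc reaching [i] is deemed to end in the type [c]. This records a cycle
    whose points before [i] have been removed: [c] is the type of the first of
    them, at which the cycle has to close. *)
Definition bent_arcs A i c s : flow X :=
  \sum_(a in A) unit_flow (tau a, if s a == i then c else tau (s a)).

Definition cycle_sum A k : R :=
  \sum_(s | perm_on A s) alpha ^+ #|porbits s| * (arcs A s == k)%:R.

Definition bent_sum A i c k : R :=
  \sum_(s | perm_on A s) alpha ^+ #|porbits s| * (bent_arcs A i c s == k)%:R.

Lemma bent_sum_self A i k : bent_sum A i (tau i) k = cycle_sum A k.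
Proof.
apply: eq_bigr => s _; congr (_ * (_ == _)%:R).
by apply: eq_bigr => a _; case: eqP => // ->.
Qed.

Lemma bent_arcs_peel A i c j s : i \in A -> j \in A -> perm_on (A :\ i) s ->
  bent_arcs A i c (s * tperm i j)%g =
  if j == i then unit_flow (tau i, c) + arcs (A :\ i) s
  else unit_flow (tau i, tau j) + bent_arcs (A :\ i) j c s.
Proof.
move=> iA jA sA; rewrite /bent_arcs (big_setD1 i)//=.
have si : s i = i by rewrite (out_perm sA)// !inE eqxx.
have sN a : a \in A :\ i -> s a != i.
  by move=> aA; move: (aA); rewrite -(perm_closed a sA) !inE => /andP[].
rewrite permM si tpermL; case: ifPn => ji; congr (_ + _).
  apply: eq_bigr => a aA; rewrite (eqP ji) tperm1 mulg1.
  by rewrite (negPf (sN _ aA)).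
apply: eq_bigr => a aA; rewrite permM; case: tpermP => [sai|->|].
- by have := sN _ aA; rewrite sai eqxx.
- by rewrite !eqxx.
- by move=> /eqP/negPf -> /eqP/negPf ->.
Qed.

(** Either [i] is a fixed point, and the cycle closes by an arc to [c], or it is
    followed by some [j], and the arc still to be closed becomes the one that
    reaches [j]. Cycles are counted on all of [T], where a removed point is a
    fixed point: closing keeps their number, continuing loses one. *)
Lemma bent_sum_peel A i c k : i \in A ->
  alpha * bent_sum A i c k =
  alpha * cycle_sum (A :\ i) (k - unit_flow (tau i, c)) +
  \sum_(j in A :\ i) bent_sum (A :\ i) j c (k - unit_flow (tau i, tau j)).
Proof.
move=> iA; rewrite /bent_sum (sum_perm_on_peel _ iA) (big_setD1 i)//= mulrDr.
congr (_ + _).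
  congr (_ * _); apply: eq_bigr => s sA; rewrite bent_arcs_peel// eqxx.
  by rewrite tperm1 mulg1 addr_eql.
rewrite mulr_sumr; apply: eq_bigr => j; rewrite !inE => /andP[ji jA].
rewrite mulr_sumr; apply: eq_bigr => s sA; rewrite bent_arcs_peel// (negPf ji).
rewrite mulrA -exprS (porbits_peel _ sA)// ?inE ?eqxx//.
by rewrite addr_eql.
Qed.

Lemma porbits_perm1 : #|porbits (1 : {perm T})%g| = #|T|.
Proof.
rewrite /porbits card_imset// => x y.
have porbit1 z : porbit (1 : {perm T})%g z = [set z].
  apply/setP => u; rewrite inE; apply/porbitP/eqP => [[n ->]|->].
    by rewrite expg1n perm1.
  by exists 0%N; rewrite expg0 perm1.
by rewrite !porbit1 => /set1_inj.
Qed.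

Lemma cycle_sum0 k : cycle_sum set0 k = alpha ^+ #|T| * (k == 0)%:R.
Proof.
rewrite /cycle_sum (big_pred1 1%g) => [|s]; last first.
  apply/idP/eqP => [s0|->]; last exact: perm_on1.
  by apply/perm.permP => a; rewrite perm1 (out_perm s0)// inE.
by rewrite porbits_perm1 /arcs big_set0 eq_sym.
Qed.

Hypothesis alpha0 : alpha != 0.

Definition type_count A y : nat := #|[set a in A | tau a == y]|.

Definition type_fact A : R := \prod_y (type_count A y)`!%:R.

Lemma type_countD1 A i y : i \in A ->
  type_count A y = ((tau i == y) + type_count (A :\ i) y)%N.
Proof.
move=> iA; rewrite /type_count (cardsD1 i) inE iA /=; congr (_ + _)%N.
by apply: eq_card => a; rewrite !inE andbA.
Qed.

Lemma type_factD1 A i : i \in A ->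
  type_fact A = (type_count A (tau i))%:R * type_fact (A :\ i).
Proof.
move=> iA; rewrite /type_fact (bigD1 (tau i))//= [in RHS](bigD1 (tau i))//=.
rewrite mulrA -natrM (type_countD1 _ iA) eqxx add1n -factS; congr (_ * _).
apply: eq_bigr => y; rewrite eq_sym => /negPf yi.
by rewrite (type_countD1 _ iA) yi.
Qed.

(** Each of the [type_count A z] choices of [j] divides [type_fact A] by
    [type_count A z]. *)
Lemma sum_type_factD1 A z : (0 < type_count A z)%N ->
  \sum_(j in A | tau j == z) type_fact (A :\ j) = type_fact A.
Proof.
case/card_gt0P => i; rewrite inE => /andP[iA /eqP <-].
rewrite (eq_bigr (fun=> type_fact (A :\ i))) => [|j /andP[jA /eqP ji]].
  rewrite sumr_const (type_factD1 iA) mulr_natl; congr (_ *+ _).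
  by apply: eq_card => a; rewrite !inE.
apply: eq_bigr => y _; congr (_`!%:R).
by have := type_countD1 y iA; rewrite (type_countD1 y jA) ji => /addnI.
Qed.

Lemma sum_type_count A : \sum_x (type_count A x)%:Z = #|A|%:Z.
Proof.
rewrite -sum1_card (partition_big tau xpredT)//= -(big_morph Posz PoszD erefl).
congr Posz; apply: eq_bigr => x _; rewrite sum1_card.
by apply: eq_card => a; rewrite !inE.
Qed.

(** The three hypotheses below are the properties of the sum over configurations
    of loops that force it to agree with [cycle_sum] up to normalization. *)
Variables (B : nat) (Z : flow X -> R).

Definition no_loop_step k : Prop := forall x, k (x, x) <= 0.

Hypothesis Z_flat : forall k, (forall x, outflow k x = 0) -> Z k = (k == 0)%:R.
Hypothesis Z_neg : forall k x, outflow k x < 0 -> Z k = 0.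
Hypothesis Z_walk : forall k x n, (n <= B)%N -> no_loop_step k ->
  flow_total k = n%:Z ->
  (outflow k x)%:~R * Z k =
  alpha * \sum_(q < n) \sum_(s : q.-tuple X) Z (k - flow_of (steps (x :: s))).

(** The points of the cycle through a point [i] of type [x] are removed one
    after the other; their types form a closed walk from [x], and summing over
    this walk gives the recursion [Z_walk]. The factorials count the points
    of each type available when the walk is lifted to [T]. *)
Lemma cycle_sumE n A k : #|A| = n -> (n <= B)%N -> no_loop_step k ->
  (forall x, outflow k x = (type_count A x)%:Z) ->
  cycle_sum A k = alpha ^+ #|~: A| * type_fact A * Z k.
Proof.
elim/ltn_ind: n A k => n IHn A k cA nB ks kA.
have [A0|[i iA]] := set_0Vmem A.
  have t0 x : type_count A x = 0%N by apply: eq_card0 => a; rewrite A0 !inE.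
  rewrite Z_flat => [|x]; last by rewrite kA t0.
  rewrite A0 cycle_sum0 setC0 cardsT -A0 /type_fact big1 ?mulr1// => x _.
  by rewrite t0.
have step_shift y z k' : no_loop_step k' -> no_loop_step (k' - unit_flow (y, z)).
  by move=> kk x; rewrite !ffunE; have := kk x; case: eqP => _ /=; lia.
(* Once the first points of the cycle are removed, what remains to be chosen is
   a walk from the type of the current point j to the closing type c. *)
have bent m : forall A' j c k', #|A'| = m -> (m <= n)%N ->
    no_loop_step k' -> j \in A' ->
    (forall x, outflow k' x = (type_count A' x)%:Z) ->
  bent_sum A' j c k' = alpha ^+ #|~: A'| * type_fact (A' :\ j) *
    (alpha * \sum_(q < m) \sum_(s : q.-tuple X)
               Z (k' - flow_of (walk_steps (tau j) s c))).
  elim: m => [|m IHm] A' j c k' cA' mn ks' jA' kA'.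
    by move/cards0_eq: cA' jA' => ->; rewrite inE.
  apply: (mulfI alpha0); rewrite bent_sum_peel//.
  have cA'j : #|A' :\ j| = m by have := cardsD1 j A'; rewrite jA' cA' => -[].
  have Cj : #|~: (A' :\ j)| = #|~: A'|.+1.
    by have := cardsC A'; rewrite -(cardsC (A' :\ j)) cA'j cA' addSnnS => /addnI.
  have out_shift z x :
      outflow (k' - unit_flow (tau j, z)) x = (type_count (A' :\ j) x)%:Z.
    rewrite outflowB outflow_unit /= kA' (type_countD1 _ jA') eq_sym; lia.
  rewrite (IHn m)//; [|lia|exact: step_shift].
  pose G z := \sum_(q < m) \sum_(s : q.-tuple X)
    Z (k' - flow_of (walk_steps (tau j) (z :: s) c)).
  rewrite (eq_bigr (fun u => alpha ^+ #|~: A'|.+1 * alpha *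
      (type_fact (A' :\ j :\ u) * G (tau u)))); last first.
    move=> u uA; rewrite (IHm (A' :\ j))//; [|lia|exact: step_shift].
    rewrite Cj [RHS]mulrACA; congr (_ * (_ * _)).
    apply: eq_bigr => q _; apply: eq_bigr => s _.
    by rewrite /walk_steps /= flow_of_cons opprD addrA.
  have GE : \sum_(u in A' :\ j) type_fact (A' :\ j :\ u) * G (tau u) =
      type_fact (A' :\ j) * \sum_z G z.
    rewrite mulr_sumr (partition_big tau xpredT)//=; apply: eq_bigr => z _.
    rewrite (eq_bigr (fun u => type_fact (A' :\ j :\ u) * G z)); last first.
      by move=> u /andP[_ /eqP->].
    rewrite -mulr_suml.
    have [z0|z0] := posnP (type_count (A' :\ j) z); last first.
      by rewrite sum_type_factD1.
    (* No point of type z is left in A', whereas the walks in G z leave z. *)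
    suff -> : G z = 0 by rewrite !mulr0.
    rewrite /G big1// => q _; rewrite big1// => s _; apply: (@Z_neg _ z).
    rewrite /walk_steps /= flow_of_cons opprD addrA outflowB out_shift z0.
    have := outflow_walk z s c; rewrite /walk_steps /=; lia.
  rewrite -mulr_sumr GE big_ord_recl (big_pred1 [tuple]) => [|s]; last first.
    by apply/esym/eqP; exact: tuple0.
  rewrite /walk_steps /= flow_of_cons [flow_of [::]]big_nil addr0.
  pose F (w : seq X) := Z (k' - flow_of (walk_steps (tau j) w c)).
  rewrite [in RHS](eq_bigr (fun q : 'I_m => \sum_z \sum_(s : q.-tuple X) F (z :: s))).
    rewrite [in RHS]exchange_big /= Cj -/(\sum_z G z) exprS.
    ring.
  by move=> q _; exact: (big_tupleS q F).
rewrite -(bent_sum_self A i) (bent n)//.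
under eq_bigr do under eq_bigr do rewrite -steps_cons.
rewrite -Z_walk//; last by rewrite flow_total_outflow -cA -sum_type_count; apply: eq_bigr.
rewrite kA (type_factD1 iA) !mulrA; congr (_ * _).
by rewrite -!mulrA; congr (_ * _); rewrite mulrC.
Qed.

End AlphaPermanent.

(** * Permutations with prescribed arcs *)

Section Arrangements.
Context {R : fieldType} {X T : finType}.
Implicit Types (A : {set T}) (s : {perm T}) (k : flow X) (tau rho : T -> X).

Definition inflow k (y : X) : int := \sum_x k (x, y).

Lemma inflowB k k' y : inflow (k - k') y = inflow k y - inflow k' y.
Proof. by rewrite /inflow -sumrB; apply: eq_bigr => x _; rewrite !ffunE. Qed.

Lemma inflow_unit p y : inflow (unit_flow p) y = (y == p.2)%:Z.
Proof.
case: p => a b; rewrite /inflow (bigD1 a)//= big1 ?addr0 => [|x xa].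
  by rewrite ffunE xpair_eqE eqxx.
by rewrite ffunE xpair_eqE (negPf xa).
Qed.

(** Images have types of their own, because removing a point of the domain
    moves the types of two images. *)
Definition arcs_between A tau rho s : flow X :=
  \sum_(a in A) unit_flow (tau a, rho (s a)).

Definition arrangements A tau rho k : R :=
  \sum_(s | perm_on A s) (arcs_between A tau rho s == k)%:R.

Definition flow_fact k : R := \prod_p (`|k p|)`!%:R.

Lemma arcs_between_ge0 A tau rho s p : 0 <= arcs_between A tau rho s p.
Proof. by rewrite sum_ffunE; apply: sumr_ge0 => a _; rewrite ffunE. Qed.

Lemma flow_factD1 k p : 0 < k p ->
  flow_fact k = `|k p|%:R * flow_fact (k - unit_flow p).
Proof.
move=> kp; rewrite /flow_fact (bigD1 p)//= [in RHS](bigD1 p)//= mulrA -natrM.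
rewrite !ffunE eqxx; congr (_%:R * _).
  case: (k p) kp => -[|m]//= _; rewrite factS; congr (_ * _`!)%N.
  by rewrite subn1.
by apply: eq_bigr => q /negPf qp; rewrite !ffunE qp subr0.
Qed.

Lemma type_count_tperm A rho i j y : i \in A -> j \in A ->
  type_count (rho \o tperm i j) (A :\ i) y = type_count rho (A :\ j) y.
Proof.
move=> iA jA; rewrite /type_count -(card_imset _ (@perm_inj _ (tperm i j))).
apply: eq_card => a; apply/imsetP/idP => [[b]|]; rewrite !inE.
  move=> /andP[/andP[bi bA] /= yb] ->; rewrite yb andbT.
  case: tpermP bi => [->|->|_ /eqP->]; rewrite ?eqxx//= => bi.
  by rewrite eq_sym bi ?iA.
move=> /andP[/andP[aj aA] ya]; exists (tperm i j a); last by rewrite tpermK.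
rewrite !inE /= tpermK ya andbT.
case: tpermP aj => [->|->|/eqP-> _ _]; rewrite ?eqxx//= => ai.
by rewrite eq_sym ai ?jA.
Qed.

Lemma arcs_between_peel A tau rho i j s : i \in A -> perm_on (A :\ i) s ->
  arcs_between A tau rho (s * tperm i j)%g =
  unit_flow (tau i, rho j) + arcs_between (A :\ i) tau (rho \o tperm i j) s.
Proof.
move=> iA sA; rewrite /arcs_between (big_setD1 i)//= permM.
rewrite (out_perm sA) ?inE ?eqxx// tpermL; congr (_ + _).
by apply: eq_bigr => a _; rewrite permM.
Qed.

(** Multinomial counting: once the image [j] of a point [i] is chosen, the same
    problem remains with [i] removed among the points and [j] among the images.
    A type [z] of [j] contributes in proportion to [k (tau i, z)], and these
    numbers add up to the outflow at [tau i]. *)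
Lemma arrangementsE A tau rho k : (forall p, 0 <= k p) ->
  (forall x, outflow k x = (type_count tau A x)%:Z) ->
  (forall y, inflow k y = (type_count rho A y)%:Z) ->
  arrangements A tau rho k * flow_fact k = type_fact tau A * type_fact rho A.
Proof.
have [n] := ubnP #|A|; elim: n A rho k => // n IHn A rho k An k0 kout kin.
have [A0|[i iA]] := set_0Vmem A.
  have t0 r x : type_count r A x = 0%N by apply: eq_card0 => a; rewrite A0 !inE.
  have kE : k = 0.
    apply/ffunP => -[x y]; rewrite ffunE; apply/eqP.
    have /eqP := kout x; rewrite t0 psumr_eq0// => /allP/(_ y); apply.
    by rewrite mem_index_enum.
  have tf r : type_fact r A = 1 :> R by rewrite /type_fact big1// => x _; rewrite t0.
  rewrite !tf mulr1 /flow_fact big1 ?mulr1 => [|p _]; last by rewrite kE ffunE.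
  rewrite /arrangements (big_pred1 1%g) => [|s]; last first.
    apply/idP/eqP => [|->]; last exact: perm_on1.
    by rewrite A0 => s0; apply/perm.permP => a; rewrite perm1 (out_perm s0)// inE.
  by rewrite /arcs_between A0 big_set0 kE eqxx.
have peel j : j \in A ->
    (\sum_(s | perm_on (A :\ i) s)
       (arcs_between A tau rho (s * tperm i j)%g == k)%:R) * flow_fact k =
    (k (tau i, rho j))%:~R * (type_fact tau (A :\ i) * type_fact rho (A :\ j)).
  move=> jA.
  have [kij|kij] := ltrP 0 (k (tau i, rho j)); last first.
    have kE : k (tau i, rho j) = 0 by apply/eqP; rewrite eq_le kij k0.
    rewrite kE mul0r big1 ?mul0r// => s sA; rewrite arcs_between_peel//.
    case: eqP => // /ffunP/(_ (tau i, rho j)); rewrite kE ffunE [unit_flow _ _]ffunE eqxx.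
    have := arcs_between_ge0 (A :\ i) tau (rho \o tperm i j) s (tau i, rho j).
    by case: (arcs_between _ _ _ _ _).
  rewrite (flow_factD1 kij) mulrCA -[k _ in RHS]gez0_abs ?ltW//; congr (_ * _).
  have <- : type_fact (rho \o tperm i j) (A :\ i) = type_fact rho (A :\ j) :> R.
    by apply: eq_bigr => y _; rewrite type_count_tperm.
  rewrite -(IHn _ _ (k - unit_flow (tau i, rho j))).
  - congr (_ * _); apply: eq_bigr => s sA.
    by rewrite arcs_between_peel// addr_eql.
  - by move: An; rewrite (cardsD1 i) iA.
  - by move=> p; rewrite !ffunE; case: eqP => [->|_] /=; have := k0 p; lia.
  - by move=> x; rewrite outflowB outflow_unit /= kout (type_countD1 _ _ iA) eq_sym; lia.
  - move=> y; rewrite inflowB inflow_unit /= kin type_count_tperm//.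
    by rewrite (type_countD1 _ _ jA) eq_sym; lia.
rewrite /arrangements (sum_perm_on_peel _ iA) mulr_suml (eq_bigr _ peel).
under eq_bigr do rewrite mulrCA.
rewrite -mulr_sumr (type_factD1 _ iA) [RHS]mulrAC [RHS]mulrC; congr (_ * _).
rewrite (partition_big rho xpredT)//=.
rewrite (eq_bigr (fun z => (k (tau i, z))%:~R * type_fact rho A)) => [|z _].
  rewrite -mulr_suml; congr (_ * _).
  by have /(congr1 (intr : int -> R)) := kout (tau i); rewrite rmorph_sum.
rewrite (eq_bigr (fun j => (k (tau i, z))%:~R * type_fact rho (A :\ j))); last first.
  by move=> j /andP[_ /eqP->].
rewrite -mulr_sumr.
have [z0|z0] := posnP (type_count rho A z); last by rewrite sum_type_factD1.
have /eqP := kin z; rewrite z0 psumr_eq0// => /allP/(_ (tau i)).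
by rewrite mem_index_enum => /(_ isT)/eqP ->; rewrite !mul0r.
Qed.

End Arrangements.

(** * Rotations and multiplicity *)

Section Periods.
Context {T : finType}.
Implicit Types s t u : seq T.

Lemma rot_iter s i : (i <= size s)%N -> rot i s = iter i (rot 1) s.
Proof.
elim: i => [|i IHi] ip; first by rewrite rot0.
by rewrite rotS// IHi// ltnW.
Qed.

(** [t] is a prefix of [u ++ t], hence of [u]; what remains of [u] after it still
    commutes with [t]. *)
Lemma commuting_cat t u n : (0 < size t)%N -> size u = (n * size t)%N ->
  u ++ t = t ++ u -> u = flatten (nseq n t).
Proof.
move=> t0; elim: n u => [|n IHn] u su utu; first exact: size0nil.
have tu : take (size t) u = t.
  have : take (size t) (u ++ t) = t by rewrite utu take_size_cat.
  by rewrite takel_cat// su mulSn leq_addr.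
rewrite -(cat_take_drop (size t) u) tu /=; congr (_ ++ _); apply: IHn.
  by rewrite size_drop su mulSn addKn.
move: utu; rewrite -{1 2}(cat_take_drop (size t) u) tu -catA => /eqP.
by rewrite eqseq_cat// eqxx /= => /eqP.
Qed.

Lemma size_flatten_nseq m t : size (flatten (nseq m t)) = (m * size t)%N.
Proof. by elim: m => //= m IHm; rewrite size_cat IHm mulSn. Qed.

Lemma flatten_nseq_comm m t : flatten (nseq m t) ++ t = t ++ flatten (nseq m t).
Proof. by elim: m => [|m IHm] /=; rewrite ?cats0// -catA IHm. Qed.

(** This replaces the repeated block by a period, which is easier to count. *)
Lemma repeatsP s m : (0 < size s)%N ->
  reflect [/\ (0 < m)%N, (m %| size s)%N & rot (size s %/ m) s = s] (repeats s m).
Proof.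
move=> s0; apply: (iffP existsP) => [[t' /eqP st]|[m0 mp rs]].
  have tp : size (val t') = (size s %/ m)%N := size_tuple t'.
  move: (val t') tp st => t tp {t'} st.
  have sz := congr1 size st; rewrite size_flatten_nseq tp in sz.
  have m0 : (0 < m)%N by case: (m) sz => // sz; rewrite sz in s0.
  split => //; first by apply/dvdnP; exists (size s %/ m)%N; rewrite mulnC.
  rewrite -tp [in rot _ _]st [RHS]st; case: (m) m0 => // k _ /=.
  by rewrite rot_size_cat flatten_nseq_comm.
have d0 : (0 < size s %/ m)%N by rewrite divn_gt0// dvdn_leq.
have sz : size (take (size s %/ m) s) = (size s %/ m)%N.
  by rewrite size_takel// leq_div.
exists (Tuple (introT eqP sz)) => /=; apply/eqP.
case: m m0 mp rs d0 sz => // m _ mp rs d0 sz.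
rewrite /= -[LHS](cat_take_drop (size s %/ m.+1)); congr (_ ++ _).
apply: commuting_cat; rewrite ?sz//.
  by rewrite size_drop -{1}(divnK mp) mulnS addKn mulnC.
by rewrite cat_take_drop.
Qed.

(** The rotations fixing [s] are the multiples of a least period [d], which
    divides the size [p] of [s]; both sides are [p %/ d]. *)
Lemma multiplicityE s : (0 < size s)%N ->
  (\sum_(i < size s) (rot i s == s))%N = multiplicity s.
Proof.
move=> s0; set p := size s in s0 *; pose E i := iter i (rot 1) s == s.
have ED i j : E i -> E (j + i)%N = E j by rewrite /E iterD => /eqP ->.
have Ep : E p by rewrite /E -rot_iter// rot_size.
have exd : exists d, (0 < d)%N && E d by exists p; rewrite s0.
have [d /andP[d0 Ed] dmin] := ex_minnP exd.
have EM k : E (k * d)%N by elim: k => [|k IHk]; rewrite ?/E//= mulSn -/(E _) ED.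
have EE i : E i = (d %| i)%N.
  rewrite {1}(divn_eq i d) addnC ED// /dvdn.
  have [->|i0] := posnP (i %% d); first by rewrite /E eqxx.
  apply/negP => Ei; have := dmin (i %% d)%N; rewrite i0 Ei => /(_ isT).
  by rewrite leqNgt ltn_mod d0.
have dp : (d %| p)%N by rewrite -EE.
transitivity (p %/ d)%N.
  rewrite divn_count_dvd (eq_bigr (fun i : 'I_p => (d %| i : nat)%N)) => [|i _].
    pose f i : nat := (d %| i)%N.
    rewrite -(big_mkord xpredT f) big_add1 /=; apply: (@addIn (f p)).
    by rewrite -big_nat_recr// big_nat_recl// addnC /f dvdn0 dp.
  by rewrite rot_iter ?(ltnW (ltn_ord i))// -/(E _) EE.
apply/eqP; rewrite eqn_leq; apply/andP; split.
  have pd : (p %/ d < p.+1)%N by rewrite ltnS leq_div.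
  apply: (leq_bigmax_cond (Ordinal pd)) => /=; apply/repeatsP => //.
  split; [by rewrite divn_gt0// dvdn_leq|by apply/dvdnP; exists d; rewrite mulnC divnK|].
  by rewrite divnA// mulKn// rot_iter; [exact/eqP|exact: dvdn_leq].
apply/bigmax_leqP => m /repeatsP [//|m0 mp]; rewrite rot_iter ?leq_div//.
move=> /eqP; rewrite -/(E _) EE => dm.
rewrite leq_divRL// -[leqRHS](divnK mp) mulnC leq_mul2r.
by rewrite (dvdn_leq _ dm) ?orbT// divn_gt0// dvdn_leq.
Qed.

(** The fibres of [i |-> rot i s] over the rotations of [s] have the same
    cardinal, as rotating by one shifts [i] cyclically. *)
Lemma sum_rot_eq s t : (0 < size s)%N ->
  (\sum_(i < size s) (rot i s == t))%N = (rotation s t * multiplicity s)%N.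
Proof.
move=> s0; pose f u := (\sum_(i < size s) (rot i s == u))%N.
have f_rot u : f u = f (rot 1 u).
  rewrite /f [RHS](reindex_inj (@ordS_inj _)) /=; apply: eq_bigr => i _.
  congr nat_of_bool; rewrite -(inj_eq (@rot_inj 1 _)); congr (_ == _).
  have ip := ltn_ord i; rewrite -rotS //=.
  move: ip; rewrite leq_eqVlt => /orP[/eqP ->|ip].
    by rewrite modnn rot0 rot_size.
  by rewrite modn_small.
rewrite -/(f t); case: (boolP (rotation s t)) => [st|/negP st].
  rewrite mul1n -multiplicityE// -/(f s).
  by apply: (rotation_ind (Q := fun u => f u = f s) _ st) => // u <-.
rewrite /f big1// => i _; apply/eqP; rewrite eqb0; apply/eqP => e.
by apply: st; apply/rotationP; exists i.
Qed.

End Periods.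

(** * Loops of a given size *)

Section LoopsBySize.
Context {X : finType}.

Definition loop_word (l : loop X) : seq X := val (repr l).

Lemma loop_word_size l : (2 <= size (loop_word l))%N.
Proof. exact: valP (repr l). Qed.

Lemma size_tuple_ge2 p (t : p.+2.-tuple X) : (2 <= size (val t))%N.
Proof. by rewrite size_tuple. Qed.

Definition loop_of_tuple p (t : p.+2.-tuple X) : loop X :=
  (\pi_(loop X) (exist _ (val t) (size_tuple_ge2 t)))%qT.

(** The index is offset by two, the least number of jumps of a loop. *)
Definition loops_of_size p : seq (loop X) :=
  undup [seq loop_of_tuple t | t <- enum {: p.+2.-tuple X}].

Lemma loop_of_tuple_eq p (t : p.+2.-tuple X) l :
  (loop_of_tuple t == l) = rotation (loop_word l) t.
Proof.
rewrite -[l in LHS]reprK /loop_of_tuple; rewrite rotation_sym.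
by apply/eqP/idP => [/eqmodP//|?]; apply/eqmodP.
Qed.

Lemma mem_loops_of_size p l :
  (l \in loops_of_size p) = (size (loop_word l) == p.+2).
Proof.
rewrite mem_undup; apply/mapP/eqP => [[t _ ->]|lp].
  have /eqP := erefl (loop_of_tuple t); rewrite loop_of_tuple_eq => /rotationP[i].
  by move/(congr1 size); rewrite size_rot size_tuple.
exists (Tuple (introT eqP lp)); first by rewrite mem_enum.
by apply/esym/eqP; rewrite loop_of_tuple_eq rotation_refl.
Qed.

(** If [m] is the multiplicity of [l], then [l] has [p.+2 %/ m] based versions,
    each met [m] times when a representative is rotated [p.+2] times. *)
Lemma sum_rotations (R : fieldType) (G : seq X -> R) p l :
  size (loop_word l) = p.+2 ->
  \sum_(i < p.+2) G (rot i (loop_word l)) =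
  (multiplicity (loop_word l))%:R * \sum_(t : p.+2.-tuple X | loop_of_tuple t == l) G t.
Proof.
move=> lp; have rot_sz (i : 'I_p.+2) : size (rot i (loop_word l)) == p.+2.
  by rewrite size_rot lp.
rewrite (eq_bigr (fun i => \sum_(t | t == Tuple (rot_sz i)) G t)); last first.
  by move=> i _; rewrite big_pred1_eq.
under eq_bigr do rewrite big_mkcond.
rewrite exchange_big mulr_sumr [RHS]big_mkcond /=; apply: eq_bigr => t _.
rewrite loop_of_tuple_eq.
have := @sum_rot_eq _ (loop_word l) t; rewrite lp => /(_ isT).
move/(congr1 (fun n => n%:R * G t)); rewrite natr_sum mulr_suml => sumE.
transitivity (\sum_(i < p.+2) (rot i (loop_word l) == t)%:R * G t).
  apply: eq_bigr => i _; rewrite -val_eqE /= eq_sym.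
  by case: eqP; rewrite ?mul1r ?mul0r.
by rewrite sumE; case: rotation; rewrite ?mul1n ?mul0n ?mul0r.
Qed.

Lemma sum_based_loops (R : nmodType) p (G : p.+2.-tuple X -> R) :
  \sum_(t : p.+2.-tuple X) G t =
  \sum_(l <- loops_of_size p) \sum_(t : p.+2.-tuple X | loop_of_tuple t == l) G t.
Proof.
under [RHS]eq_bigr do rewrite big_mkcond.
rewrite exchange_big /=; apply: eq_bigr => t _.
have tl : loop_of_tuple t \in loops_of_size p.
  by rewrite mem_undup; apply: map_f; rewrite mem_enum.
rewrite (bigD1_seq _ tl (undup_uniq _))/= eqxx big1 ?addr0// => l.
by rewrite eq_sym => /negPf ->.
Qed.

Lemma multiplicity_gt0 (s : seq X) : (0 < size s)%N -> (0 < multiplicity s)%N.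
Proof.
move=> s0; rewrite -multiplicityE//; case: (size s) s0 => // n _.
by rewrite big_ord_recl rot0 eqxx.
Qed.

Definition loops_up_to n : seq (loop X) := flatten [seq loops_of_size p | p <- iota 0 n].

Lemma mem_loops_up_to n l : (l \in loops_up_to n) = (size (loop_word l) < n.+2)%N.
Proof.
apply/flatten_mapP/idP => [[p]|lp].
  by rewrite mem_iota mem_loops_of_size add0n => /= pn /eqP ->.
exists (size (loop_word l)).-2; last first.
  by rewrite mem_loops_of_size; case: (size _) (loop_word_size l) => [|[]].
rewrite mem_iota add0n /=.
by case: (size _) (loop_word_size l) lp => [|[]].
Qed.

Lemma loops_up_toS n : loops_up_to n.+1 = loops_up_to n ++ loops_of_size n.
Proof. by rewrite /loops_up_to -addn1 iotaD map_cat flatten_cat /= cats0. Qed.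

Lemma uniq_loops_up_to n : uniq (loops_up_to n).
Proof.
elim: n => // n IHn; rewrite loops_up_toS cat_uniq IHn undup_uniq andbT /=.
apply/hasPn => l; rewrite mem_loops_of_size mem_loops_up_to => /eqP ->.
by rewrite ltnn.
Qed.

Lemma big_loops_up_to (R : nmodType) n (F : loop X -> R) :
  \sum_(l <- loops_up_to n) F l = \sum_(p < n) \sum_(l <- loops_of_size p) F l.
Proof.
rewrite big_flatten big_map.
by rewrite -(big_mkord xpredT (fun p => \sum_(l <- loops_of_size p) F l)) /index_iota subn0.
Qed.

Lemma count_rot_head (s : seq X) x :
  (\sum_(i < size s) (head x (rot i s) == x))%N = count_mem x s.
Proof.
rewrite -sum1_count [RHS](big_nth x) big_mkord [RHS]big_mkcond /=.
apply: eq_bigr => i _; rewrite -nth0 /rot nth_cat size_drop subn_gt0 ltn_ord.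
by rewrite nth_drop addn0; case: ifP.
Qed.

(** A loop of multiplicity [m] making [v] visits to [x] has [v %/ m] based
    versions starting at [x]. *)
Lemma sum_loops_through (R : numFieldType) (F : loop X -> R) x n :
  \sum_(l <- loops_up_to n)
     (count_mem x (loop_word l))%:R / (multiplicity (loop_word l))%:R * F l =
  \sum_(p < n) \sum_(t : p.+2.-tuple X | head x t == x) F (loop_of_tuple t).
Proof.
rewrite big_loops_up_to; apply: eq_bigr => p _.
rewrite [RHS]big_mkcond sum_based_loops; apply: eq_big_seq => l.
rewrite mem_loops_of_size => /eqP lp.
have m0 : (multiplicity (loop_word l))%:R != 0 :> R.
  by rewrite pnatr_eq0 -lt0n multiplicity_gt0// lp.
rewrite (eq_bigr (fun t : p.+2.-tuple X => (head x t == x)%:R * F l)) => [|t /eqP <-].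
  rewrite -mulr_suml; congr (_ * _).
  apply: (mulfI m0); rewrite -(sum_rotations (fun s => (head x s == x)%:R) lp).
  by rewrite mulrC divfK// -count_rot_head lp natr_sum.
by case: eqP; rewrite ?mul1r ?mul0r.
Qed.

Lemma flow_of_steps_word p (t : p.+2.-tuple X) :
  flow_of (steps (loop_word (loop_of_tuple t))) = flow_of (steps t).
Proof.
apply: perm_big; rewrite perm_sym; apply: perm_steps.
by rewrite -loop_of_tuple_eq.
Qed.

Lemma flow_of_steps_jumps (s : seq X) p : flow_of (steps s) p = (jumps s p.1 p.2)%:Z.
Proof. by rewrite flow_of_count /jumps -surjective_pairing. Qed.

Lemma outflow_steps (s : seq X) x : outflow (flow_of (steps s)) x = (count_mem x s)%:Z.
Proof.
have sz : size s = size (rot 1 s) by rewrite size_rot.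
rewrite /steps -[s in count_mem x s](@unzip1_zip _ _ s (rot 1 s)) ?sz//.
elim: (zip _ _) => [|p l IHl]; last first.
  by rewrite flow_of_cons outflowD outflow_unit IHl /= eq_sym.
by rewrite /outflow big1// => y _; rewrite /flow_of big_nil ffunE.
Qed.

Lemma size_steps (s : seq X) : size (steps s) = size s.
Proof. by rewrite size_zip size_rot minnn. Qed.

Lemma flow_total_flow_of (l : seq (X * X)) : flow_total (flow_of l) = (size l)%:Z.
Proof.
elim: l => [|p l IHl].
  by rewrite /flow_total big1// => p _; rewrite /flow_of big_nil ffunE.
rewrite flow_of_cons /flow_total; under eq_bigr do rewrite ffunE.
by rewrite big_split /= -!/(flow_total _) flow_total_unit IHl.
Qed.

End LoopsBySize.

(** * Configurations with a given flow *)

Section Configurations.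
Context {R : numFieldType} {X I : finType} (B : nat) (j : I -> flow X) (a : I -> R).
Implicit Types (n : {ffun I -> 'I_B.+1}) (k : flow X).

(** A configuration contains [n i] copies of the item [i]. The bound [B] makes
    the sum finite; no configuration with a flow of total at most [B] exceeds
    it, since each item takes at least one step. *)
Definition config_flow n : flow X := \sum_i j i *+ n i.

Definition config_weight n : R := \prod_i (a i ^+ n i / (n i)`!%:R).

Definition config_sum k : R := \sum_(n | config_flow n == k) config_weight n.

Hypothesis j_ge0 : forall i p, 0 <= j i p.
Hypothesis j_gt0 : forall i, 0 < flow_total (j i).

Lemma outflow_ge0 i x : 0 <= outflow (j i) x.
Proof. by apply: sumr_ge0 => y _. Qed.

Lemma outflow_config n x : outflow (config_flow n) x = \sum_i outflow (j i) x *+ n i.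
Proof.
rewrite /outflow /config_flow; under eq_bigr do rewrite sum_ffunE.
rewrite exchange_big /=; apply: eq_bigr => i _.
by rewrite -sumrMnl; apply: eq_bigr => y _; rewrite ffunMnE.
Qed.

Lemma flow_total_config n : flow_total (config_flow n) = \sum_i flow_total (j i) *+ n i.
Proof.
rewrite /flow_total /config_flow; under eq_bigr do rewrite sum_ffunE.
rewrite exchange_big /=; apply: eq_bigr => i _.
by rewrite -sumrMnl; apply: eq_bigr => y _; rewrite ffunMnE.
Qed.

Lemma le_flow_total_config n i : (n i)%:Z <= flow_total (config_flow n).
Proof.
rewrite flow_total_config (bigD1 i)//= -[(n i)%:Z]addr0 lerD//.
  by rewrite -[leLHS]natz lerMn2r -gtz0_ge1 j_gt0 orbT.
by apply: sumr_ge0 => l _; rewrite mulrn_wge0// ltW.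
Qed.

Lemma config_sum_flat k : (forall x, outflow k x = 0) -> config_sum k = (k == 0)%:R.
Proof.
move=> k0; pose n0 : {ffun I -> 'I_B.+1} := [ffun=> ord0].
have conf0 n : config_flow n == k -> n = n0.
  move=> /eqP nk; apply/ffunP => i; apply/val_inj; rewrite ffunE /=; apply/eqP.
  have := le_flow_total_config n i; rewrite nk flow_total_outflow big1//.
  by rewrite lez_nat leqn0.
have n00 : config_flow n0 = 0 by rewrite /config_flow big1// => i _; rewrite ffunE.
rewrite /config_sum; have [kE|kN] := eqVneq k 0; last first.
  rewrite big1// => n nk; move: (nk); rewrite (conf0 _ nk) n00 => /eqP k0'.
  by rewrite k0' eqxx in kN.
rewrite (big_pred1 n0) => [|n]; last first.
  by apply/idP/eqP => [|->]; [exact: conf0|rewrite n00 kE].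
by rewrite /config_weight big1// => i _; rewrite ffunE divr1.
Qed.

Lemma config_sum_neg_at k p : k p < 0 -> config_sum k = 0.
Proof.
move=> kp; rewrite /config_sum big1// => n /eqP nk; move: kp.
rewrite -nk sum_ffunE ltNge sumr_ge0// => i _.
by rewrite ffunMnE mulrn_wge0.
Qed.

Lemma config_sum_neg_total k : flow_total k < 0 -> config_sum k = 0.
Proof.
move=> k0; rewrite /config_sum big1// => n /eqP nk; move: k0.
rewrite -nk flow_total_config ltNge sumr_ge0// => i _.
by rewrite mulrn_wge0// ltW.
Qed.

Lemma config_sum_neg k x : outflow k x < 0 -> config_sum k = 0.
Proof.
move=> kx; rewrite /config_sum big1// => n /eqP nk; move: kx.
rewrite -nk outflow_config ltNge sumr_ge0// => i _.
by rewrite mulrn_wge0// outflow_ge0.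
Qed.

(** Removal of one copy of [i], from
    [n%:R * (a i ^+ n / n`!%:R) = a i * (a i ^+ n.-1 / n.-1`!%:R)] for [n > 0]. *)
Lemma config_sum_shift k i : flow_total k <= B ->
  \sum_(n | config_flow n == k) (n i)%:R * config_weight n =
  a i * config_sum (k - j i).
Proof.
move=> kB; pose up n : {ffun I -> 'I_B.+1} :=
  [ffun l => if l == i then inord (n i).+1 else n l].
pose down n : {ffun I -> 'I_B.+1} :=
  [ffun l => if l == i then inord (n i).-1 else n l].
rewrite (bigID (fun n => n i == 0 :> nat)) /= big1 => [|n /andP[_ /eqP ->]]; last first.
  by rewrite mul0r.
have upi n : (n i < B)%N -> up n i = (n i).+1 :> nat by move=> nB; rewrite ffunE eqxx inordK.
have downK n : n i != 0 :> nat -> up (down n) = n.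
  move=> n0; apply/ffunP => l; rewrite !ffunE eqxx; case: eqP => // ->.
  have n1 : (n i).-1.+1 = n i :> nat by rewrite prednK// lt0n.
  by apply/val_inj; rewrite /= !inordK ?n1// ltnW// n1.
have upK n : (n i < B)%N -> down (up n) = n.
  move=> niB; apply/ffunP => l; rewrite !ffunE eqxx; case: eqP => // ->.
  by apply/val_inj; rewrite /= !inordK// ltnW.
have upB n : up n i != 0 :> nat -> (n i < B)%N.
  rewrite ffunE eqxx; have := ltn_ord (n i); rewrite ltnS leq_eqVlt.
  case/orP => // /eqP niB; rewrite /inord /insubd insubF ?eqxx//=.
  by rewrite niB ltnn.
rewrite add0r (reindex_onto up down) /= => [|n /andP[_ n0]]; last exact: downK.
rewrite /config_sum mulr_sumr.
(* Adding a copy of i stays within the bound B: the total is below B. *)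
have nB n : config_flow n == k - j i -> (n i < B)%N.
  move=> /eqP nk; have := le_flow_total_config n i; rewrite nk flow_totalB.
  by have := j_gt0 i; lia.
have up_flow n : (n i < B)%N -> config_flow (up n) = j i + config_flow n.
  move=> niB; rewrite /config_flow (bigD1 i)//= [in RHS](bigD1 i)//= upi//.
  rewrite mulrS addrA; congr (_ + _); apply: eq_bigr => l li.
  by rewrite ffunE (negPf li).
apply: eq_big => n.
  apply/idP/idP => [/andP[/andP[nk n0] /eqP dn]|nk].
    by rewrite up_flow ?upB// addr_eql in nk.
  have niB := nB _ nk; rewrite up_flow// addr_eql nk upi//=.
  by rewrite upK.
move=> /andP[/andP[nk n0] /eqP dn]; have niB := upB _ n0.
rewrite /config_weight (bigD1 i)//= [in RHS](bigD1 i)//= upi// mulrA [RHS]mulrA.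
congr (_ * _); last by apply: eq_bigr => l li; rewrite ffunE (negPf li).
rewrite factS natrM exprS; field.
by rewrite addrC natr1 !pnatr_eq0 -lt0n fact_gt0.
Qed.

(** The outflow at [x] counts the visits to [x]: mark one of them, and remove the
    item that makes it. *)
Lemma config_sum_rec k x : flow_total k <= B ->
  (outflow k x)%:~R * config_sum k =
  \sum_i (outflow (j i) x)%:~R * a i * config_sum (k - j i).
Proof.
move=> kB; rewrite [in LHS]/config_sum mulr_sumr.
rewrite (eq_bigr (fun n => \sum_i (outflow (j i) x)%:~R * ((n i)%:R * config_weight n))).
  rewrite exchange_big; apply: eq_bigr => i _.
  by rewrite -mulr_sumr config_sum_shift// mulrA.
move=> n /eqP <-; rewrite outflow_config rmorph_sum mulr_suml; apply: eq_bigr => i _.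
by rewrite rmorphMn /= -mulr_natr mulrA.
Qed.

End Configurations.

(** * The coefficient of the alpha-permanent *)

Section Coefficients.
Context {X : finType} (R : realType) (e : rel X).

Definition flow_of_network (k : X -> X -> nat) : flow X := [ffun p => (k p.1 p.2)%:Z].

(** A factor outside the edges kills the product; it also makes the flow of the
    factors positive at a place where [k] vanishes. *)
Lemma mcoeff_formal_prod (I : finType) (f g : I -> X) (k : X -> X -> nat) :
  network e k ->
  mpoly.mcoeff (edge_monomial e k) (\prod_i formal_transition R e (f i) (g i)) =
  ((\sum_i unit_flow (f i, g i)) == flow_of_network k)%:R.
Proof.
move=> ke.
have [/forallP fg|] := boolP [forall i, e (f i) (g i)]; last first.
  rewrite negb_forall => /existsP[i fgi].
  rewrite (bigD1 i)//= {1}/formal_transition insubF ?(negPf fgi)// mul0r raddf0.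
  apply/esym/eqP; rewrite pnatr_eq0 eqb0; apply/negP => /eqP/ffunP/(_ (f i, g i)).
  rewrite sum_ffunE (bigD1 i)//= !ffunE eqxx ke; last by right.
  have : 0 <= \sum_(i0 | i0 != i) unit_flow (f i0, g i0) (f i, g i).
    by apply: sumr_ge0 => l _; rewrite ffunE.
  by case: (\sum_(_ | _) _).
pose pe i : oriented_edge e := exist _ (f i, g i) (fg i).
rewrite (eq_bigr (fun i => mpoly.mpolyX R (mpoly.mnm1 (enum_rank (pe i))))); last first.
  move=> i _; rewrite /formal_transition insubT //= => ?.
  by congr (mpoly.mpolyX _ (mpoly.mnm1 (enum_rank _))); apply: val_inj.
rewrite -(big_map (fun i => mpoly.mnm1 (enum_rank (pe i))) xpredT (fun m => mpoly.mpolyX R m)).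
rewrite mpoly.mpolyX_prod mpoly.mcoeffX big_map; congr (_%:R); congr nat_of_bool.
apply/eqP/eqP => [/mpoly.mnmP E|/ffunP E].
  apply/ffunP => p; rewrite sum_ffunE ffunE.
  have [ep|epN] := boolP (e p.1 p.2); last first.
    rewrite ke ?big1//; last by right.
    by move=> i _; rewrite ffunE; case: eqP epN => // -> /=; rewrite fg.
  have := E (enum_rank (exist _ p ep : oriented_edge e)).
  rewrite mpoly.mnm_sumE mpoly.multinomE tnth_mktuple enum_rankK /= => <-.
  rewrite -natz natr_sum; apply: eq_bigr => i _.
  rewrite mpoly.mnm1E ffunE (inj_eq enum_rank_inj) -val_eqE /= eq_sym natz.
  by case: p {ep} => ? ?.
apply/mpoly.mnmP => l; rewrite mpoly.mnm_sumE mpoly.multinomE tnth_mktuple.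
have := E (val (enum_val l)); rewrite sum_ffunE ffunE => El.
apply/eqP; rewrite -eqz_nat; apply/eqP; rewrite -[RHS]El -natz natr_sum.
apply: eq_bigr => i _.
rewrite mpoly.mnm1E ffunE -{1}[l]enum_valK (inj_eq enum_rank_inj) -val_eqE /=.
by rewrite eq_sym natz.
Qed.

Lemma type_count_repeated (m : X -> nat) x :
  type_count (tnth (in_tuple (repeated m))) [set: 'I_(size (repeated m))] x = m x.
Proof.
transitivity (count_mem x (repeated m)).
  rewrite -sum1_count big_tnth /type_count -sum1_card; apply: eq_bigl => i.
  by rewrite !inE.
rewrite /repeated count_flatten -map_comp sumnE big_map big_enum /=.
rewrite (bigD1 x)//= big1 ?addn0 => [|y /negPf yx]; rewrite count_nseq /= ?eqxx ?mul1n//.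
by rewrite yx.
Qed.

Lemma per_coefE (alpha : R) (k : X -> X -> nat) : network e k ->
  per_coef e alpha k =
  cycle_sum alpha (tnth (in_tuple (repeated (outdeg k)))) setT (flow_of_network k).
Proof.
move=> ke; rewrite /per_coef /alpha_per raddf_sum /cycle_sum /=.
apply: eq_big => [s|s _]; first by apply/esym/fintype.subsetP => a _; rewrite inE.
rewrite -rmorphXn /= mpoly.mcoeffCM; congr (_ * _).
under eq_bigr do rewrite mxE.
rewrite (mcoeff_formal_prod (fun i => tnth _ i) (fun i => tnth _ (s i)) ke).
by congr (_ == _)%:R; apply: eq_bigl => i; rewrite inE.
Qed.

Lemma flow_total_network (k : X -> X -> nat) :
  flow_total (flow_of_network k) = (\sum_x outdeg k x)%:Z.
Proof.
rewrite flow_total_outflow (big_morph Posz PoszD erefl); apply: eq_bigr => x _.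
rewrite /outflow (big_morph Posz PoszD erefl).
by apply: eq_bigr => y _; rewrite ffunE.
Qed.

Lemma outflow_network (k : X -> X -> nat) x :
  outflow (flow_of_network k) x = (outdeg k x)%:Z.
Proof.
rewrite /outflow /outdeg (big_morph Posz PoszD erefl).
by apply: eq_bigr => y _; rewrite ffunE.
Qed.

Section LoopConfigurations.
Variables (alpha : R) (K : nat).

Definition loop_flow (i : 'I_(size (@loops_up_to X K))) : flow X :=
  flow_of (steps (loop_word (tnth (in_tuple (loops_up_to K)) i))).

(** The intensity of a loop, without its product of transition
    probabilities. *)
Definition loop_rate (i : 'I_(size (@loops_up_to X K))) : R :=
  alpha / (multiplicity (loop_word (tnth (in_tuple (loops_up_to K)) i)))%:R.

Local Notation Z := (config_sum K loop_flow loop_rate).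

Lemma loop_flow_ge0 i p : 0 <= loop_flow i p.
Proof. by rewrite flow_of_count. Qed.

Lemma loop_flow_gt0 i : 0 < flow_total (loop_flow i).
Proof.
rewrite flow_total_flow_of size_steps ltz_nat.
by apply: leq_trans (loop_word_size _).
Qed.

(** A loop marked at a visit to [x] is read as a closed walk from [x], and
    [sum_loops_through] absorbs the multiplicities. The walk without further
    vertex ([q = 0]) needs a step from [x] to [x], and a walk of more than [n]
    steps exhausts [k]: neither contributes. *)
Lemma config_sum_walk k x n : (n <= K)%N -> no_loop_step k -> flow_total k = n%:Z ->
  (outflow k x)%:~R * Z k =
  alpha * \sum_(q < n) \sum_(s : q.-tuple X) Z (k - flow_of (steps (x :: s))).
Proof.
move=> nK ks kn.
rewrite (config_sum_rec _ loop_flow_gt0) ?kn ?lez_nat//.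
pose F (s : seq X) := Z (k - flow_of (steps s)).
pose G l := (count_mem x (loop_word l))%:R / (multiplicity (loop_word l))%:R *
  F (loop_word l) : R.
transitivity (\sum_(i < size (loops_up_to K)) alpha * G (tnth (in_tuple (loops_up_to K)) i)).
  apply: eq_bigr => i _; rewrite outflow_steps /G /loop_rate /F -/(loop_flow i).
  by rewrite -pmulrn mulrCA !mulrA.
rewrite -mulr_sumr -(big_tnth _ _ _ xpredT G) sum_loops_through; congr (_ * _).
have big_neg q (s : q.-tuple X) : (n <= q)%N -> F (x :: s) = 0.
  move=> nq; rewrite /F; apply: config_sum_neg_total.
    exact: loop_flow_gt0.
  by rewrite flow_totalB kn flow_total_flow_of size_steps /= size_tuple; lia.
transitivity (\sum_(q < K.+1) \sum_(s : q.-tuple X) F (x :: s)); last first.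
  rewrite -(big_mkord xpredT (fun q => \sum_(s : q.-tuple X) F (x :: s))).
  rewrite (big_cat_nat (n := n))//=; last by rewrite ltnW.
  rewrite [X in _ + X]big_nat_cond [X in _ + X]big1 ?addr0 ?big_mkord//.
  by move=> q /andP[/andP[nq _] _]; rewrite big1// => s _; exact: big_neg.
rewrite big_ord_recl [X in _ = X + _]big1 ?add0r => [|s _]; last first.
  rewrite tuple0; apply: (@config_sum_neg_at _ _ _ _ _ _ loop_flow_ge0 _ (x, x)).
  rewrite /steps /= flow_of_cons [flow_of _]big_nil addr0.
  by have := ks x; rewrite !ffunE eqxx /=; lia.
apply: eq_bigr => q _; rewrite (eq_bigr (fun t : q.+2.-tuple X => F t)) => [|t _]; last first.
  by rewrite /F flow_of_steps_word.
rewrite big_mkcond (big_tupleS q.+1 (fun t => if head x t == x then F t else 0)).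
rewrite (bigD1 x)//= eqxx [X in _ + X]big1 ?addr0// => z /negPf zx.
by rewrite big1// => s _; rewrite zx.
Qed.

End LoopConfigurations.

(** The coefficient is a sum over the permutations whose arcs have the types
    prescribed by [k], and [config_sum] satisfies the recursion of these sums. *)
Lemma per_coef_loops (alpha : R) (k : X -> X -> nat) (K := (\sum_x outdeg k x)%N) :
  alpha != 0 -> network e k ->
  per_coef e alpha k =
  (\prod_x (outdeg k x)`!)%:R *
  config_sum K (@loop_flow K) (@loop_rate alpha K) (flow_of_network k).
Proof.
move=> alpha0 ke; rewrite per_coefE//; set tau := tnth _.
have KE : #|[set: 'I_(size (repeated (outdeg k)))]| = K.
  apply/eqP; rewrite -eqz_nat -(sum_type_count tau).
  rewrite /K (big_morph Posz PoszD erefl); apply/eqP/eq_bigr => x _.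
  by rewrite type_count_repeated.
pose Z := config_sum K (@loop_flow K) (@loop_rate alpha K).
rewrite (@cycle_sumE _ _ _ _ tau alpha0 K Z _ _ _ K)//.
- rewrite setCT cards0 expr0 mul1r; congr (_ * _).
  by rewrite natr_prod; apply: eq_bigr => x _; rewrite type_count_repeated.
- exact: config_sum_flat (@loop_flow_gt0 K).
- exact: config_sum_neg (@loop_flow_ge0 K).
- by move=> *; exact: config_sum_walk.
- by move=> x; rewrite ffunE ke//; left.
- by move=> x; rewrite outflow_network type_count_repeated.
Qed.

(** For [alpha = 1] the cycles do not matter any more. *)
Lemma per_coef1 (k : X -> X -> nat) : eulerian e k ->
  per_coef e 1 k * (\prod_x \prod_y (k x y)`!)%:R = (\prod_x (outdeg k x)`!)%:R ^+ 2 :> R.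
Proof.
move=> [ke kin]; rewrite per_coefE//; set tau := tnth _.
transitivity ((arrangements [set: 'I_(size (repeated (outdeg k)))] tau tau (flow_of_network k)
    * flow_fact (flow_of_network k)) : R).
  congr (_ * _).
    by apply: eq_bigr => s _; rewrite expr1n mul1r.
  rewrite pair_big natr_prod; apply: eq_bigr => -[x y] _ /=.
  by rewrite ffunE.
rewrite arrangementsE => [| | x| y].
- by rewrite expr2 /type_fact natr_prod; congr (_ * _); apply: eq_bigr => x _;
    rewrite type_count_repeated.
- by move=> p; rewrite ffunE.
- by rewrite outflow_network type_count_repeated.
rewrite type_count_repeated kin /inflow (big_morph Posz PoszD erefl).
by apply: eq_bigr => x _; rewrite ffunE.
Qed.

End Coefficients.

(** * Jacobi formula *)

Section Jacobi.
Context {F : fieldType} {n : nat}.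
Implicit Types A B : 'M[F]_n.

(** The reciprocal polynomial of [char_poly A]. *)
Definition fredholm_poly A : {poly F} := \det (1%:M - 'X *: map_mx polyC A).

Lemma fredholm_polyE A t : (fredholm_poly A).[t] = \det (1%:M - t *: A).
Proof.
rewrite -[LHS]/(horner_eval t _) -det_map_mx; congr (\det _).
apply/matrixP => i j; rewrite !mxE /= /horner_eval !hornerE.
by case: eqP => _; rewrite ?mulr1n ?mulr0n !hornerE.
Qed.

Lemma coef1_prod_unipotent (I : Type) (r : seq I) (p : I -> {poly F}) :
  (forall i, (p i)`_0 = 1) ->
  (\prod_(i <- r) p i)`_0 = 1 /\ (\prod_(i <- r) p i)`_1 = \sum_(i <- r) (p i)`_1.
Proof.
move=> p1; elim: r => [|i r [IH0 IH1]]; first by rewrite !big_nil !coef1.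
rewrite !big_cons !coefM !big_ord_recl !big_ord0 /= !addr0 /bump /= !subn0 subnn.
by rewrite !p1 IH0 IH1 !mul1r mulr1 addrC.
Qed.

(** At first order only the identity contributes: any other permutation moves
    two points, and each of them gives a factor divisible by ['X]. *)
Lemma fredholm_poly_coef1 A : (fredholm_poly A)`_1 = - \tr A.
Proof.
pose M := 1%:M - 'X *: map_mx polyC A : 'M[{poly F}]_n.
have M0 i j : (M i j)`_0 = (i == j)%:R.
  by rewrite !mxE coefB coefXM subr0; case: eqP => _; rewrite ?coef1 ?coef0.
have M1 i j : (M i j)`_1 = - A i j.
  rewrite !mxE coefB coefXM coefC /=.
  by case: eqP => _; rewrite ?mulr1n ?mulr0n ?coef1 ?coef0 sub0r.
rewrite /fredholm_poly -/M /determinant coef_sum (bigD1 1%g)//= [X in _ + X]big1 ?addr0.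
  rewrite odd_perm1 expr0 mul1r.
  have [|_ ->] := @coef1_prod_unipotent _ (index_enum _) (fun i => M i ((1%g : 'S_n) i)).
    by move=> i; rewrite perm1 M0 eqxx.
  by rewrite -sumrN; apply: eq_bigr => i _; rewrite perm1 M1.
move=> s s1.
have [i si] : exists i, s i != i.
  apply/existsP; apply: contraNT s1; rewrite negb_exists => /forallP s1.
  by apply/eqP/perm.permP => i; rewrite perm1; apply/eqP; rewrite -[_ == _]negbK.
have ssi : s (s i) != s i by rewrite (inj_eq perm_inj).
rewrite (bigD1 i)//= (bigD1 (s i))//=.
set u := M i (s i); set v := M (s i) _; set w := \prod_(_ | _) _.
have u0 : u`_0 = 0 by rewrite M0 eq_sym (negPf si).
have v0 : v`_0 = 0 by rewrite M0 eq_sym (negPf ssi).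
rewrite -signr_odd; set c := _ ^+ _.
have -> : c * (u * (v * w)) = (c * w) * (u * v) by ring.
rewrite coefM !big_ord_recl big_ord0 /bump /= addr0 !coefM !big_ord_recl !big_ord0 /=.
by rewrite /bump /= u0 v0 !(mul0r, mulr0, addr0).
Qed.

Lemma resolvent_eq A t : 1%:M - t *: A \in unitmx ->
  A = (1%:M - t *: A) *m (A *m invmx (1%:M - t *: A)).
Proof.
move=> uA; rewrite mulmxA.
rewrite (_ : (1%:M - t *: A) *m A = A *m (1%:M - t *: A)) ?mulmxK//.
by rewrite mulmxBl mulmxBr mul1mx mulmx1 -scalemxAl scalemxAr.
Qed.

(** As [1 - (t + s) A = (1 - t A) (1 - s B)] for [B = A (1 - t A)^-1], the
    derivative at [t] reduces to a derivative at [0]. *)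
Lemma deriv_fredholm_poly A t : 1%:M - t *: A \in unitmx ->
  (fredholm_poly A)^`().[t] =
  - (fredholm_poly A).[t] * \tr (A *m invmx (1%:M - t *: A)).
Proof.
move=> uA; set B := A *m invmx _.
have shift : fredholm_poly A \Po ('X + t%:P) = (fredholm_poly A).[t] *: fredholm_poly B.
  rewrite fredholm_polyE -mul_polyC.
  have -> : (\det (1%:M - t *: A))%:P = \det (map_mx polyC (1%:M - t *: A)).
    by rewrite det_map_mx.
  have -> : fredholm_poly A \Po ('X + t%:P) =
      \det (map_mx (comp_poly ('X + t%:P)) (1%:M - 'X *: map_mx polyC A)).
    by rewrite det_map_mx.
  rewrite -det_mulmx; congr (\det _).
  have AB : A = (1%:M - t *: A) *m B.
    exact: resolvent_eq.
  rewrite mulmxBr mulmx1 -scalemxAr -map_mxM -AB map_mxB map_mxZ.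
  apply/matrixP => i j; rewrite !mxE /= comp_polyX comp_polyC polyCB polyCM.
  have -> : (i == j)%:R \Po ('X + t%:P) = (i == j)%:R%:P by rewrite -polyC_natr comp_polyC.
  ring.
have := congr1 (fun p => p^`().[0]) shift.
rewrite deriv_comp derivD derivX derivC addr0 mulr1 horner_comp !hornerE => ->.
rewrite derivZ hornerZ mulNr -mulrN; congr (_ * _).
by rewrite horner_coef0 coef_deriv mulr1n fredholm_poly_coef1.
Qed.

End Jacobi.

(** * A strictly superharmonic function *)

Section Superharmonic.
Context {R : realType} {X : finType} (C : X -> X -> R) (kappa : X -> R).
Hypothesis C_sym : forall x y, C x y = C y x.
Hypothesis C_ge0 : forall x y, 0 <= C x y.
Hypothesis C_diag : forall x, C x x = 0.
Hypothesis energy_pos : positive_definite_energy C kappa.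

Local Notation lam := (lambda C kappa).
Local Notation P := (transition C kappa).

Lemma energyE f :
  energy C kappa f = \sum_x f x * (lam x * f x - \sum_y C x y * f y).
Proof.
rewrite /energy.
have -> : \sum_x \sum_y C x y * (f x - f y) ^+ 2 =
   2 * \sum_x \sum_y (C x y * f x ^+ 2 - f x * (C x y * f y)).
  rewrite [RHS]mulr_natl mulr2n [X in _ = _ + X]exchange_big -big_split.
  apply: eq_bigr => x _; rewrite -big_split; apply: eq_bigr => y _ /=.
  by rewrite (C_sym y x); ring.
rewrite mulKf ?pnatr_eq0// -big_split; apply: eq_bigr => x _ /=.
rewrite sumrB -mulr_suml -mulr_sumr /lambda; ring.
Qed.

(** This is the energy of the indicator function of [x]. *)
Lemma lambda_gt0 x : 0 < lam x.
Proof.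
have := energy_pos (f := fun y => (y == x)%:R).
rewrite energyE (bigD1 x)//= [X in _ + X]big1 => [|y /negPf ->]; last by rewrite mul0r.
rewrite eqxx (bigD1 x)//= C_diag [X in 0 * _ + X]big1 => [|y /negPf ->]; last by rewrite mulr0.
rewrite !mul1r mulr1 mul0r !addr0 subr0; apply; exists x.
by rewrite eqxx oner_eq0.
Qed.

Lemma transition_ge0 x y : 0 <= P x y.
Proof. by rewrite divr_ge0// ltW// lambda_gt0. Qed.

Lemma energy_transition f :
  energy C kappa f = \sum_x lam x * (f x * (f x - \sum_y P x y * f y)).
Proof.
rewrite energyE; apply: eq_bigr => x _; rewrite [RHS]mulrCA; congr (_ * _).
rewrite mulrBr; congr (_ - _).
rewrite mulr_sumr; apply: eq_bigr => y _.
by rewrite /transition mulrA mulrCA divff ?mulr1// gt_eqF// lambda_gt0.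
Qed.

Lemma sum_mx_of (F : X -> R) : \sum_(j < #|X|) F (enum_val j) = \sum_x F x.
Proof. by rewrite -(big_enum_val (A := X) F). Qed.

(** A function in the kernel of [1 - P] has energy zero. *)
Lemma unitmx_transition : 1%:M - mx_of P \in unitmx.
Proof.
rewrite unitmxE unitfE -det_tr; apply/det0P => -[v v0 vA].
pose f x := v 0 (enum_rank x).
have fP x : f x - \sum_y P x y * f y = 0.
  have /matrixP/(_ 0 (enum_rank x)) := vA; rewrite !mxE => vE.
  rewrite -[RHS]vE -sum_mx_of /f.
  under [RHS]eq_bigr do rewrite !mxE mulrBr.
  rewrite sumrB [X in _ = X - _](bigD1 (enum_rank x))//= eqxx mulr1.
  rewrite [X in _ = _ + X - _]big1 ?addr0.
    congr (_ - _); apply: eq_bigr => j _.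
    by rewrite enum_rankK enum_valK mulrC.
  by move=> j /negPf jx; rewrite eq_sym jx mulr0.
have [x fx] : exists x, f x != 0.
  apply/existsP; apply: contraNT v0; rewrite negb_exists => /forallP f0.
  apply/eqP/matrixP => i j; rewrite ord1 mxE -(enum_valK j); apply/eqP.
  by have := f0 (enum_val j); rewrite negbK.
have := energy_pos (ex_intro _ x fx).
by rewrite energy_transition big1 ?ltxx// => y _; rewrite fP !mulr0.
Qed.

(** [h = (1 - P)^-1 1] is the expected lifetime of the chain. It is nonnegative
    because the energy of its negative part cannot be positive. *)
Lemma lifetime : exists h : X -> R, forall x, 0 <= h x /\ h x = 1 + \sum_y P x y * h y.
Proof.
pose u : 'cV[R]_#|X| := invmx (1%:M - mx_of P) *m const_mx 1.
have uE : u - mx_of P *m u = const_mx 1.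
  by rewrite -{1}[u]mul1mx -mulmxBl mulmxA mulmxV ?unitmx_transition// mul1mx.
pose h x := u (enum_rank x) 0.
have hE x : h x - \sum_y P x y * h y = 1.
  have /matrixP/(_ (enum_rank x) 0) := uE; rewrite !mxE => <-.
  rewrite /h !mxE; congr (_ - _); rewrite -sum_mx_of; apply: eq_bigr => j _.
  by rewrite !mxE enum_rankK enum_valK.
exists h => x; split; last by rewrite -(hE x) subrK.
pose hn y := Num.max 0 (- h y).
have hn0 y : 0 <= hn y by rewrite /hn le_max lexx.
rewrite leNgt; apply/negP => hx.
have := energy_pos (f := hn).
have -> : energy C kappa hn = \sum_y lam y * (hn y * (hn y - \sum_z P y z * hn z)).
  exact: energy_transition.
rewrite ltNge sumr_le0 => [/(_ _)/negP|y _].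
  apply=> //; exists x; rewrite gt_eqF// /hn lt_max oppr_gt0 hx orbT//.
rewrite pmulr_rle0 ?lambda_gt0//.
have [hy|hy] := lerP 0 (h y).
  by rewrite /hn max_l ?oppr_le0// mul0r.
rewrite pmulr_rle0; last by rewrite /hn lt_max oppr_gt0 hy orbT.
have -> : hn y = - h y by rewrite /hn max_r// oppr_ge0 ltW.
rewrite subr_le0 -[h y](subrK (\sum_z P y z * h z)) hE opprD -sumrN.
apply: (@le_trans _ _ (\sum_z - (P y z * h z))); first by rewrite gerDr lerN10.
apply: ler_sum => z _; rewrite -mulrN ler_wpM2l ?transition_ge0//.
by rewrite /hn le_max lexx orbT.
Qed.

(** The lifetime [h] satisfies [P h = h - 1], and [1 >= h / H] when [H] bounds
    [h]. This makes [P] a strict contraction for a weighted supremum norm. *)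
Lemma superharmonic : exists (h : X -> R) (r : R),
  [/\ 0 <= r, r < 1, forall x, 1 <= h x & forall x, \sum_y P x y * h y <= r * h x].
Proof.
have [h h_life] := lifetime; pose H := 1 + \sum_x h x.
have h0 x : 0 <= h x := (h_life x).1.
have H1 : 1 <= H by rewrite lerDl sumr_ge0.
have Hh x : h x <= H.
  by rewrite /H (bigD1 x)//= addrCA lerDl addr_ge0// sumr_ge0.
have H0 : 0 < H by apply: lt_le_trans H1.
exists h, (1 - H^-1); split.
- by rewrite subr_ge0 invf_le1.
- by rewrite gtrBl invr_gt0.
- move=> x; rewrite (h_life x).2 lerDl sumr_ge0// => y _.
  by rewrite mulr_ge0// transition_ge0.
move=> x; rewrite mulrBl mul1r lerBrDr {2}(h_life x).2 [leLHS]addrC lerD2r.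
by rewrite mulrC ler_pdivrMr// mul1r.
Qed.

End Superharmonic.

(** * Loop weights and traces of powers *)

From mathcomp Require Import all_classical all_reals all_analysis.
From mathcomp Require Import measurable_realfun.
Import numFieldNormedType.Exports.

Local Open Scope classical_set_scope.
Local Open Scope ring_scope.

Section WalkWeights.
Context {R : realType} {X : finType} (P : X -> X -> R).

Definition steps_weight (s : seq (X * X)) : R := \prod_(p <- s) P p.1 p.2.

Lemma steps_weight_count (s : seq (X * X)) :
  steps_weight s = \prod_p P p.1 p.2 ^+ count_mem p s.
Proof.
elim: s => [|q s IHs]; first by rewrite /steps_weight big_nil big1.
rewrite /steps_weight big_cons -/(steps_weight s) IHs.
under [RHS]eq_bigr do rewrite /= exprD.
rewrite big_split [X in _ = X * _](bigD1 q)//= eqxx expr1.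
rewrite [X in _ = _ * X * _]big1 ?mulr1// => p.
by rewrite eq_sym => /negPf ->.
Qed.

Lemma power_mx_of q y c :
  (mx_of P ^+ q.+1) (enum_rank y) (enum_rank c) =
  \sum_(s : q.-tuple X) steps_weight (walk_steps y s c).
Proof.
elim: q y => [|q IHq] y.
  rewrite (big_pred1 [tuple]) => [|s]; last by apply/esym/eqP; exact: tuple0.
  by rewrite expr1 mxE !enum_rankK /steps_weight big_seq1.
rewrite exprS mxE (big_tupleS q (fun s => steps_weight (walk_steps y s c))).
rewrite -[RHS]sum_mx_of; apply: eq_bigr => j _; rewrite mxE enum_rankK.
rewrite -[j in (mx_of P ^+ _) j _]enum_valK IHq mulr_sumr.
by apply: eq_bigr => s _; rewrite /steps_weight /walk_steps /= big_cons.
Qed.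

Lemma trace_power q :
  \tr (mx_of P ^+ q.+1) = \sum_(t : q.+1.-tuple X) steps_weight (steps t).
Proof.
rewrite (big_tupleS q (fun s => steps_weight (steps s))) -[RHS]sum_mx_of.
apply: eq_bigr => i _; rewrite -[i in LHS]enum_valK power_mx_of.
by apply: eq_bigr => s _; rewrite steps_cons.
Qed.

Lemma steps_weight_rotation s t : rotation s t ->
  steps_weight (steps t) = steps_weight (steps s).
Proof. by move=> st; apply/perm_big/perm_steps. Qed.

(** The [p.+2 %/ m] based versions of a loop of multiplicity [m] share its
    factor [1 / m] equally: each receives [1 / p.+2]. *)
Lemma sum_loop_weight p :
  \sum_(l <- loops_of_size p) loop_weight P l = \tr (mx_of P ^+ p.+2) / p.+2%:R.
Proof.
rewrite trace_power mulr_suml.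
rewrite (sum_based_loops (fun t : p.+2.-tuple X => steps_weight (steps t) / p.+2%:R)).
apply: eq_big_seq => l; rewrite mem_loops_of_size => /eqP lp.
have m0 : (multiplicity (loop_word l))%:R != 0 :> R.
  by rewrite pnatr_eq0 -lt0n multiplicity_gt0// lp.
rewrite -mulr_suml; apply: (mulfI m0); rewrite [RHS]mulrA.
rewrite -(sum_rotations (fun s => steps_weight (steps s)) lp).
rewrite (eq_bigr (fun=> steps_weight (steps (loop_word l)))) => [|i _]; last first.
  by apply: steps_weight_rotation; apply/rotationP; exists i.
rewrite sumr_const card_ord -(mulr_natr (steps_weight _)) mulfK ?pnatr_eq0//.
by rewrite mulrC divfK.
Qed.

End WalkWeights.

(** * The exponential of the trace series *)

Section FredholmExponential.
Context {R : realType} {n : nat} (A : 'M[R]_n) (h : 'I_n -> R) (r : R).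
Hypothesis A_ge0 : forall i j, 0 <= A i j.
Hypothesis r_ge0 : 0 <= r.
Hypothesis r_lt1 : r < 1.
Hypothesis h_ge1 : forall i, 1 <= h i.
Hypothesis Ah : forall i, \sum_j A i j * h j <= r * h i.

Let H : R := \sum_i h i.

Lemma power_ge0 p i j : 0 <= (A ^+ p) i j.
Proof.
elim: p i j => [|p IHp] i j; first by rewrite expr0 mxE ler0n.
by rewrite exprS mxE sumr_ge0// => l _; rewrite mulr_ge0.
Qed.

Lemma power_h p i : \sum_j (A ^+ p) i j * h j <= r ^+ p * h i.
Proof.
elim: p i => [|p IHp] i.
  rewrite !expr0 mul1r (bigD1 i)//= mxE eqxx mul1r big1 ?addr0// => j /negPf ji.
  by rewrite mxE eq_sym ji mul0r.
rewrite (eq_bigr (fun j => \sum_l A i l * ((A ^+ p) l j * h j))); last first.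
  by move=> j _; rewrite exprS mxE mulr_suml; apply: eq_bigr => l _; rewrite mulrA.
rewrite exchange_big /=.
apply: (@le_trans _ _ (\sum_l A i l * (r ^+ p * h l))).
  by apply: ler_sum => l _; rewrite -mulr_sumr ler_wpM2l.
under eq_bigr do rewrite mulrCA.
by rewrite -mulr_sumr exprSr -mulrA ler_wpM2l// exprn_ge0.
Qed.

Lemma power_le p i j : (A ^+ p) i j <= H * r ^+ p.
Proof.
have h0 l : 0 <= h l by apply: le_trans (h_ge1 l).
apply: (@le_trans _ _ ((A ^+ p) i j * h j)).
  by rewrite -[leLHS]mulr1 ler_wpM2l// power_ge0.
apply: (@le_trans _ _ (r ^+ p * h i)).
  apply: le_trans (power_h p i); rewrite (bigD1 j)//= lerDl.
  by apply: sumr_ge0 => l _; rewrite mulr_ge0// power_ge0.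
rewrite mulrC ler_wpM2r ?exprn_ge0//.
by rewrite /H (bigD1 i)//= lerDl sumr_ge0.
Qed.

Lemma H_ge0 : 0 <= H.
Proof. by apply: sumr_ge0 => i _; apply: le_trans (h_ge1 i). Qed.

Lemma le0_geometric (a b : R) : (forall p, a <= b * r ^+ p) -> a <= 0.
Proof.
move=> ab; have rn : `|r| < 1 by rewrite ger0_norm.
have := cvg_geometric b rn => /cvg_lim bl.
rewrite -(bl _)//; apply: limr_ge; first by apply: cvgP (cvg_geometric b rn).
by near=> p; exact: ab.
Unshelve. all: by end_near. Qed.

(** If [v = t v A], then [v = t ^+ p v A ^+ p] for all [p], which tends to 0. *)
Lemma unitmx_resolvent (t : R) : 0 <= t <= 1 -> 1%:M - t *: A \in unitmx.
Proof.
move=> /andP[t0 t1]; rewrite unitmxE unitfE; apply/det0P => -[v v0 vA].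
have vE : v = v *m (t *: A).
  by move: vA; rewrite mulmxBr mulmx1 => /eqP; rewrite subr_eq0 => /eqP.
have vp p : v = t ^+ p *: (v *m (A ^+ p)).
  elim: p => [|p IHp]; first by rewrite !expr0 mulmx1 scale1r.
  rewrite {1}vE {1}IHp -scalemxAr -scalemxAl scalerA -exprS; congr (_ *: _).
  by rewrite exprSr -mulmxA.
move/negP: v0; apply; apply/eqP/matrixP => i j; rewrite ord1 mxE.
apply/eqP; rewrite -normr_le0; apply: (@le0_geometric _ ((\sum_l `|v 0 l|) * H)) => p.
rewrite {1}(vp p) mxE normrM ger0_norm ?exprn_ge0//.
apply: (@le_trans _ _ `|(v *m A ^+ p) 0 j|).
  by rewrite ler_piMl// exprn_ile1.
rewrite mxE -mulrA mulr_suml; apply: le_trans (ler_norm_sum _ _ _) _.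
apply: ler_sum => l _; rewrite normrM ler_wpM2l// ger0_norm ?power_ge0//.
exact: power_le.
Qed.

(** This bounds the partial sums of [(i + 1) q ^ i] by [1 / (1 - q) ^ 2]. *)
Lemma sum_arith_geometric (q : R) N :
  (1 - q) ^+ 2 * \sum_(0 <= i < N) i.+1%:R * q ^+ i =
  1 - N.+1%:R * q ^+ N + N%:R * q ^+ N.+1.
Proof.
elim: N => [|N IHN]; first by rewrite big_nil mulr0 expr0 mulr1 mul0r addr0 subrr.
by rewrite big_nat_recr//= mulrDr IHN !exprS -[N.+2]addn2 -[N.+1]addn1 !natrD; ring.
Qed.

(** The linear factor makes this bound fit the trace series and its first two
    formal derivatives at once. *)
Lemma is_cvg_pseries_dominated (f : R ^nat) (D K : R) : 0 <= K -> r * K < 1 ->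
  (forall i, `|f i| <= D * (i.+1%:R * r ^+ i)) -> cvgn (pseries f K).
Proof.
move=> K0 rK fD; set q := r * K; have q0 : 0 <= q by rewrite mulr_ge0.
have D0 : 0 <= D.
  by have := le_trans (normr_ge0 _) (fD 0%N); rewrite expr0 !mulr1.
have v0 i : 0 <= D * (i.+1%:R * q ^+ i) by rewrite !mulr_ge0// exprn_ge0.
apply: normed_cvg; apply: (@series_le_cvg _ _ (fun i => D * (i.+1%:R * q ^+ i))) => //.
- by move=> i; exact: normr_ge0.
- move=> i; rewrite /= normrM normrX (ger0_norm K0) /q exprMn !mulrA.
  by rewrite ler_wpM2r ?exprn_ge0// -mulrA.
apply: nondecreasing_is_cvgn.
  by apply/nondecreasing_seqP => N; rewrite /series /= big_nat_recr//= lerDl.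
exists (D / (1 - q) ^+ 2) => _ [N _ <-]; rewrite /series /= -mulr_sumr.
rewrite ler_wpM2l// -[leLHS](mulKf (x := (1 - q) ^+ 2)); last first.
  by rewrite expf_neq0// subr_eq0 eq_sym lt_eqF.
rewrite sum_arith_geometric -[leRHS]mulr1 ler_wpM2l ?invr_ge0 ?sqr_ge0//.
rewrite -addrA gerDl addrC subr_le0.
apply: (@le_trans _ _ (N%:R * q ^+ N)).
  by rewrite ler_wpM2l// exprS ler_piMl ?exprn_ge0// ltW.
by rewrite ler_wpM2r ?exprn_ge0// ler_nat.
Qed.

Definition trace_coef (p : nat) : R := \tr (A ^+ p) / p%:R.

Definition trace_series (t : R) : R := limn (pseries trace_coef t).

Lemma pseries_diffs_trace p : pseries_diffs trace_coef p = \tr (A ^+ p.+1).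
Proof. by rewrite /pseries_diffs /trace_coef mulrC divfK ?pnatr_eq0. Qed.

Lemma trace_ge0 p : 0 <= \tr (A ^+ p).
Proof. by apply: sumr_ge0 => i _; exact: power_ge0. Qed.

Lemma trace_le p : \tr (A ^+ p) <= n%:R * H * r ^+ p.
Proof.
apply: (@le_trans _ _ (\sum_(i < n) H * r ^+ p)).
  by apply: ler_sum => i _; exact: power_le.
by rewrite sumr_const card_ord -(mulr_natl (H * r ^+ p)) mulrA.
Qed.

(** A radius larger than 1 within which the trace series still converges. *)
Let K : R := 2 / (1 + r).

Let r1_gt0 : 0 < 1 + r. Proof. by rewrite ltr_pwDl. Qed.

Let K_ge0 : 0 <= K. Proof. by rewrite divr_ge0// addr_ge0. Qed.

Let K_gt1 : 1 < K.
Proof. by rewrite /K ltr_pdivlMr ?r1_gt0// mul1r -natr1 addrC ltrD2r. Qed.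

Let rK : r * K < 1.
Proof.
by rewrite /K mulrA ltr_pdivrMr ?r1_gt0// mul1r mulr_natr mulr2n ltrD2r.
Qed.

Let nH_ge0 : 0 <= n%:R * H. Proof. by rewrite mulr_ge0// H_ge0. Qed.

Let trace_succ_le p : \tr (A ^+ p.+1) <= n%:R * H * r ^+ p.
Proof.
apply: le_trans (trace_le _) _; rewrite ler_wpM2l// exprS.
by rewrite ler_piMl ?exprn_ge0// ltW.
Qed.

Let trace_succ2_le p : \tr (A ^+ p.+2) <= n%:R * H * r ^+ p.
Proof.
apply: le_trans (trace_succ_le _) _; rewrite ler_wpM2l// exprS.
by rewrite ler_piMl ?exprn_ge0// ltW.
Qed.

Lemma is_cvg_trace_series : cvgn (pseries trace_coef K).
Proof.
apply: is_cvg_pseries_dominated (n%:R * H) K _ _ _ => // p.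
rewrite ger0_norm ?divr_ge0 ?trace_ge0// /trace_coef.
apply: le_trans (_ : n%:R * H * r ^+ p <= _); last first.
  by rewrite ler_wpM2l// ler_peMl ?exprn_ge0// ler1n.
case: p => [|p]; first by rewrite invr0 mulr0 mulr_ge0// exprn_ge0.
by rewrite ler_pdivrMr// (le_trans (trace_le _))// ler_peMr ?ler1n// mulr_ge0// exprn_ge0.
Qed.

Lemma is_cvg_trace_series1 : cvgn (pseries trace_coef 1).
Proof.
by apply: is_cvg_pseries_inside is_cvg_trace_series _; rewrite normr1 ger0_norm.
Qed.

Lemma is_cvg_trace_diffs : cvgn (pseries (pseries_diffs trace_coef) K).
Proof.
apply: is_cvg_pseries_dominated (n%:R * H) K _ _ _ => // p.
rewrite pseries_diffs_trace ger0_norm ?trace_ge0//.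
apply: le_trans (trace_succ_le p) _.
by rewrite ler_wpM2l// ler_peMl ?exprn_ge0// ler1n.
Qed.

Lemma is_cvg_trace_diffs2 :
  cvgn (pseries (pseries_diffs (pseries_diffs trace_coef)) K).
Proof.
apply: is_cvg_pseries_dominated (n%:R * H) K _ _ _ => // p.
rewrite {1}/pseries_diffs pseries_diffs_trace ger0_norm ?mulr_ge0 ?trace_ge0//.
by rewrite mulrCA ler_wpM2l.
Qed.

(** Geometric series for [B = A (1 - t A)^-1], with the remainder
    [t ^+ N A ^+ N B]. *)
Lemma trace_resolvent (t : R) : 0 <= t <= 1 ->
  limn (pseries (pseries_diffs trace_coef) t) = \tr (A *m invmx (1%:M - t *: A)).
Proof.
move=> t01; have /andP[t0 t1] := t01; set B := A *m invmx _.
have AB : A = B - t *: (A *m B).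
  by rewrite {1}(resolvent_eq (unitmx_resolvent t01)) mulmxBl mul1mx scalemxAl.
have rem N : pseries (pseries_diffs trace_coef) t N = \tr B - t ^+ N * \tr (A ^+ N *m B).
  elim: N => [|N IHN]; first by rewrite /pseries /series /= big_nil !expr0 mul1r mul1mx subrr.
  have -> : pseries (pseries_diffs trace_coef) t N.+1 =
      pseries (pseries_diffs trace_coef) t N + pseries_diffs trace_coef N * t ^+ N.
    by rewrite /pseries /series /= big_nat_recr.
  have AN : A ^+ N.+1 = A ^+ N *m B - t *: (A ^+ N.+1 *m B).
    by rewrite exprSr -mulmxE -mulmxA scalemxAr -mulmxBr -AB.
  rewrite IHN pseries_diffs_trace {1}AN raddfB /= mxtraceZ [t ^+ N.+1]exprS; ring.
pose b := \sum_i \sum_j `|B j i|.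
have err N : `|t ^+ N * \tr (A ^+ N *m B)| <= geometric (b * H) r N.
  rewrite /geometric /= normrM ger0_norm ?exprn_ge0//.
  apply: (@le_trans _ _ `|\tr (A ^+ N *m B)|); first by rewrite ler_piMl// exprn_ile1.
  apply: le_trans (ler_norm_sum _ _ _) _; rewrite /b -mulrA mulr_suml; apply: ler_sum => i _.
  rewrite mxE mulr_suml; apply: le_trans (ler_norm_sum _ _ _) _; apply: ler_sum => j _.
  by rewrite normrM mulrC ler_wpM2l// ger0_norm ?power_ge0// power_le.
have rn : `|r| < 1 by rewrite ger0_norm.
apply/cvg_lim => //; rewrite (funext rem) -[X in _ --> X]subr0.
apply: cvgB; first exact: cvg_cst.
have g0 := cvg_geometric (b * H) rn.
apply: (@squeeze_cvgr _ _ _ _ (fun N => - geometric (b * H) r N) (geometric (b * H) r)) => //.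
  by near=> N; rewrite -ler_norml.
by rewrite -[X in _ --> X]oppr0; apply: cvgN.
Unshelve. all: by end_near. Qed.

Lemma is_derive_trace_series (t : R) : 0 <= t <= 1 ->
  is_derive t 1 trace_series (\tr (A *m invmx (1%:M - t *: A))).
Proof.
move=> t01; rewrite -trace_resolvent//.
apply: (pseries_snd_diffs is_cvg_trace_series is_cvg_trace_diffs is_cvg_trace_diffs2).
have /andP[t0 t1] := t01.
by rewrite !ger0_norm// (le_lt_trans t1).
Qed.

Lemma trace_series0 : trace_series 0 = 0.
Proof.
rewrite /trace_series (_ : pseries trace_coef 0 = cst 0) ?lim_cst//.
apply/funext => N; rewrite /pseries /series /= big1// => -[|i] _.
  by rewrite /trace_coef invr0 mulr0 mul0r.
by rewrite expr0n mulr0.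
Qed.

(** With [S] the trace series, [exp (S t) * det (1 - t A)] has derivative 0 on
    [[0, 1]] by the Jacobi formula, and its value at 0 is 1. *)
Lemma det_exp_trace : \det (1%:M - A) = expR (- trace_series 1).
Proof.
pose F t : R := expR (trace_series t) * (fredholm_poly A).[t].
have dF (t : R) : 0 <= t <= 1 -> is_derive t (1 : R) F 0.
  move=> t01; have dS := is_derive_trace_series t01.
  have dE : is_derive t (1 : R) (expR \o trace_series) _ :=
    is_derive1_comp (is_derive_expR _) dS.
  have dp := is_derive_poly (fredholm_poly A) t.
  have dM : is_derive t (1 : R) F _ := is_deriveM dE dp.
  apply: is_derive_eq dM _.
  rewrite deriv_fredholm_poly ?unitmx_resolvent//=.
  rewrite /GRing.scale /=; ring.
have [c _] : exists2 c, c \in `[0 : R, 1] & F 1 - F 0 = 0 * (1 - 0).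
  apply: MVT_segment => //.
    by move=> t /andP[t0 t1]; apply: dF; rewrite !ltW.
  apply: derivable_within_continuous => t t01.
  by have := dF t t01; case.
rewrite mul0r /F !fredholm_polyE trace_series0 expR0 scale0r subr0 det1 mul1r scale1r.
move/eqP; rewrite subr_eq0 => /eqP E.
have e0 : expR (trace_series 1) != 0 by rewrite gt_eqF// expR_gt0.
by apply: (mulfI e0); rewrite E expRN divff.
Qed.

End FredholmExponential.

(** * Total mass of the loops *)

Section LoopSums.
Context {R : realType} {X : finType}.
Implicit Type f : loop X -> \bar R.

Lemma esum_seq (r : seq (loop X)) f : uniq r -> (forall l, 0 <= f l)%E ->
  \esum_(l in [set` r]) f l = (\sum_(l <- r) f l)%E.
Proof.
move=> r_uniq f0; rewrite (fsbig_seq _ _ r_uniq).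
by apply: esum_fset => [|l _]; [exact: finite_seq|exact: f0].
Qed.

Lemma esum_loops f : (forall l, 0 <= f l)%E ->
  \esum_(l in [set: loop X]) f l =
  (\sum_(0 <= p <oo) \sum_(l <- loops_of_size p) f l)%E.
Proof.
move=> f0; rewrite (_ : setT = \bigcup_p [set` loops_of_size p]); last first.
  apply/seteqP; split => // l _; exists (size (loop_word l)).-2 => //=.
  by rewrite mem_loops_of_size; case: (size _) (loop_word_size l) => [|[]].
rewrite nneseries_sum_bigcup//; last first.
  move=> p q _ _ [l [/=]]; rewrite !mem_loops_of_size => /eqP -> /eqP.
  by case.
by apply: eq_eseriesr => p _; rewrite esum_seq ?undup_uniq.
Qed.

Lemma measurable_esum_loops d (T : measurableType d) (g : loop X -> T -> \bar R) :
  (forall l w, 0 <= g l w)%E -> (forall l, measurable_fun setT (g l)) ->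
  measurable_fun setT (fun w => \esum_(l in [set: loop X]) g l w).
Proof.
move=> g0 mg; rewrite (_ : (fun w => _) = fun w =>
    (\sum_(0 <= p <oo) \sum_(l <- loops_of_size p) g l w)%E); last first.
  by apply/funext => w; exact: esum_loops.
apply: ge0_emeasurable_sum => [p w _ _|p _]; first exact: sume_ge0.
exact: emeasurable_sum.
Qed.

End LoopSums.

Section TotalMass.
Context {R : realType} {X : finType} (P : X -> X -> R) (h : X -> R) (r : R).
Hypothesis P_ge0 : forall x y, 0 <= P x y.
Hypothesis P_diag : forall x, P x x = 0.
Hypothesis r_ge0 : 0 <= r.
Hypothesis r_lt1 : r < 1.
Hypothesis h_ge1 : forall x, 1 <= h x.
Hypothesis Ph : forall x, \sum_y P x y * h y <= r * h x.

Lemma loop_weight_ge0 l : 0 <= loop_weight P l.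
Proof. by rewrite divr_ge0// prodr_ge0. Qed.

Let A := mx_of P.
Let A_ge0 i j : 0 <= A i j. Proof. by rewrite mxE. Qed.
Let hA (i : 'I_#|X|) := h (enum_val i).
Let hA_ge1 i : 1 <= hA i. Proof. exact: h_ge1. Qed.
Let Ah i : \sum_j A i j * hA j <= r * hA i.
Proof.
apply: le_trans (Ph _); rewrite -(sum_mx_of (fun y => P (enum_val i) y * h y)).
by apply: ler_sum => j _; rewrite mxE.
Qed.

(** The loops of size [p] have total weight [tr (P ^ p) / p]; the term [p = 1] of
    the trace series, absent from the loops, is zero as [P] has no diagonal. *)
Lemma total_loop_mass : exists2 M : R,
  loop_measure P setT = M%:E & \det (1%:M - mx_of P) = expR (- M).
Proof.
exists (trace_series A 1); last exact: (det_exp_trace A_ge0 r_ge0 r_lt1 hA_ge1 Ah).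
rewrite /loop_measure esum_loops => [|l]; last by rewrite lee_fin loop_weight_ge0.
have cv : cvgn (pseries (trace_coef A) 1).
  exact: (is_cvg_trace_series1 A_ge0 r_ge0 r_lt1 hA_ge1 Ah).
rewrite (_ : (fun n => _) = EFin \o (fun n => pseries (trace_coef A) 1 (n + 2)%N)).
  have sh : (fun n => pseries (trace_coef A) 1 (n + 2)%N) @ \oo --> trace_series A 1.
    by rewrite (cvg_shiftn 2 (pseries (trace_coef A) 1)).
  by rewrite EFin_lim; [congr EFin; exact/cvg_lim|exact: cvgP sh].
apply/funext => n /=; rewrite /pseries /series /= addn2.
rewrite big_nat_recl// big_nat_recl//= /trace_coef invr0 mulr0 mul0r add0r.
rewrite expr1 [\tr A]big1 => [|i _]; last by rewrite mxE P_diag.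
rewrite mul0r mul0r add0r -sumEFin; apply: eq_bigr => p _.
by rewrite sumEFin sum_loop_weight expr1n mulr1.
Qed.

End TotalMass.

(** * The event of a given network *)

Section EsumLemmas.
Context {R : realType} {T : choiceType}.
Implicit Types (A : set T) (f : T -> \bar R).

Lemma le_esum_term A f t : A t -> (0 <= f t)%E -> (f t <= \esum_(i in A) f i)%E.
Proof.
move=> At ft; apply: esum_ge; exists [set t]; last by rewrite fsbig_set1.
by split; [exact: finite_set1|move=> _ ->].
Qed.

End EsumLemmas.

(** At rate 0 the formula gives the Dirac mass at 0, as does the definition. *)
Lemma poisson_prob_set1 (R : realType) (rate : R) m n : 0 <= rate ->
  poisson_prob rate m [set n] = (rate ^+ n / n`!%:R * expR (- rate))%:E.
Proof.
rewrite le_eqVlt => /predU1P[<-|r0]; rewrite /poisson_prob; last first.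
  rewrite r0 esum_set1 ?lee_fin ?poisson_pmf_ge0//.
  by rewrite /poisson_pmf r0.
rewrite ltxx diracE oppr0 expR0 mulr1; case: n => [|n].
  by rewrite expr0 divr1 mem_set.
by rewrite expr0n mul0r memNset.
Qed.

Section PoissonCells.
Context {R : realType} {d : measure_display} {Omega : measurableType d}.
Context {Pr : probability Omega R} {X : finType} (L : loop X -> {RV Pr >-> nat}).
Implicit Type A : set (loop X).

Lemma measurable_points (c : loop X -> nat) A :
  measurable_fun setT (fun w => \esum_(l in A) (L l w * c l)%:R%:E : \bar R).
Proof.
rewrite (_ : (fun w => _) = fun w => \esum_(l in setT)
    (if l \in A then (L l w * c l)%:R%:E else 0%E) : \bar R).
  apply: measurable_esum_loops => [l w|l]; first by case: (l \in A).
  case: (l \in A); last exact: measurable_cst.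
  apply: (@measurableT_comp _ _ _ _ _ _ (fun n : nat => (n * c l)%:R%:E)) => //.
by apply/funext => w; rewrite esum_mkcond.
Qed.

Lemma npointsE A w : npoints L A w = \esum_(l in A) (L l w * 1)%:R%:E.
Proof. by apply: eq_esum => l _; rewrite muln1. Qed.

Lemma measurable_npoints A n : measurable [set w | npoints L A w = n%:R%:E].
Proof.
rewrite -[X in measurable X]setTI; apply: measurable_eqe => //.
rewrite (_ : npoints L A = fun w => \esum_(l in A) (L l w * 1)%:R%:E).
  exact: measurable_points.
by apply/funext => w; exact: npointsE.
Qed.

Lemma npoints_set1 l w : npoints L [set l] w = (L l w)%:R%:E.
Proof. by rewrite /npoints esum_set1. Qed.

Lemma npoints0 A w : npoints L A w = 0%E <-> forall l, A l -> L l w = 0%N.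
Proof.
split=> [A0 l Al|A0]; last by apply: esum1 => l Al; rewrite A0.
have := @le_esum_term R _ A (fun l => (L l w)%:R%:E) l Al.
rewrite -/(npoints L A w) A0 !lee_fin ler0n => /(_ isT).
by rewrite lern0 => /eqP.
Qed.

Lemma measurable_jumping x y n :
  measurable [set w | jumping_number L x y w = n%:R%:E].
Proof.
rewrite -[X in measurable X]setTI; apply: measurable_eqe => //.
rewrite (_ : jumping_number L x y = fun w => if x == y then 0%E else
    \esum_(l in setT) (L l w * loop_jumps l x y)%:R%:E)//.
by case: (x == y); [exact: measurable_cst|exact: measurable_points].
Qed.

Context (P : X -> X -> R) (alpha M : R).
Hypothesis P_ge0 : forall x y, 0 <= P x y.
Hypothesis P_diag : forall x, P x x = 0.
Hypothesis alpha_gt0 : 0 < alpha.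
Hypothesis total_mass : loop_measure P setT = M%:E.
Hypothesis L_poisson : loop_ensemble P alpha L.

Let weight_ge0 l : (0 <= (loop_weight P l)%:E)%E.
Proof. by rewrite lee_fin loop_weight_ge0. Qed.

Definition mass A : R := fine (loop_measure P A).

Lemma loop_measureID A B :
  loop_measure P A = (loop_measure P (A `&` B) + loop_measure P (A `&` ~` B))%E.
Proof. exact: esumID. Qed.

Lemma loop_measureE A : loop_measure P A = (mass A)%:E.
Proof.
rewrite fineK// ge0_fin_numE; last exact: esum_ge0.
have := loop_measureID setT A; rewrite total_mass !setTI => E.
apply: le_lt_trans (ltry M); rewrite E leeDl//; exact: esum_ge0.
Qed.

Lemma mass_ge0 A : 0 <= mass A.
Proof. by rewrite fine_ge0// esum_ge0. Qed.

Lemma prob_npoints A n : Pr [set w | npoints L A w = n%:R%:E] =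
  ((alpha * mass A) ^+ n / n`!%:R * expR (- (alpha * mass A)))%:E.
Proof.
have [+ _] := L_poisson => /(_ A); rewrite loop_measureE -EFinM => ->; last exact: ltry.
by rewrite poisson_prob_set1// mulr_ge0// ?mass_ge0// ltW.
Qed.

(** The jumping numbers ignore the jumps from a vertex to itself, so that the
    event of a given network says nothing about the loops made of them. Loops
    with such jumps do not occur, but only almost surely. *)
Definition diagonal_loops : set (loop X) := [set l | exists x, (0 < loop_jumps l x x)%N].

Lemma mass_diagonal : mass diagonal_loops = 0.
Proof.
rewrite /mass /loop_measure esum1// => l [x lx].
rewrite /loop_weight /based_weight; congr EFin; apply/eqP.
rewrite mulf_eq0 prodf_seq_eq0; apply/orP; left; apply/hasP.
exists (x, x); last by rewrite /= P_diag.
by rewrite -has_pred1 has_count.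
Qed.

Variable K : nat.
Let fl : seq (loop X) := loops_up_to K.
Let lp (i : 'I_(size fl)) : loop X := tnth (in_tuple fl) i.

(** Only the loops short enough to matter are listed; all others form the cell
    of index 0, which has to be empty. *)
Definition cell (i : 'I_(size fl).+1) : set (loop X) :=
  if unlift ord0 i is Some j then [set lp j] else ~` [set` fl].

Lemma cell0 : cell ord0 = ~` [set` fl].
Proof. by rewrite /cell unlift_none. Qed.

Lemma cellS i : cell (lift ord0 i) = [set lp i].
Proof. by rewrite /cell liftK. Qed.

Lemma mem_lp i : lp i \in fl. Proof. exact: mem_tnth. Qed.

Lemma lp_inj : injective lp.
Proof.
move=> i j /eqP; rewrite /lp !(tnth_nth (lp i)) nth_uniq ?uniq_loops_up_to//.
by move/eqP/val_inj.
Qed.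

Lemma trivIset_cell : trivIset setT cell.
Proof.
move=> i j _ _; have [i' ->|->] := unliftP ord0 i; have [j' ->|->] := unliftP ord0 j;
  rewrite ?cell0 ?cellS => -[l []] //=.
- by move=> -> /lp_inj ->.
- by move=> ->; rewrite mem_lp.
- by move=> + lj; rewrite lj mem_lp.
Qed.

Lemma mass_split : M = mass (~` [set` fl]) + \sum_i loop_weight P (lp i).
Proof.
apply: EFin_inj; rewrite -total_mass (loop_measureID _ [set` fl]) !setTI.
rewrite addeC EFinD -loop_measureE; congr (_ + _)%E.
rewrite /loop_measure (esum_seq (uniq_loops_up_to K)); last exact: weight_ge0.
by rewrite -sumEFin big_tnth.
Qed.

Implicit Type n : {ffun 'I_(size fl) -> 'I_K.+1}.

Definition cell_count n (i : 'I_(size fl).+1) : nat :=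
  if unlift ord0 i is Some j then n j else 0%N.

Lemma cell_count0 n : cell_count n ord0 = 0%N.
Proof. by rewrite /cell_count unlift_none. Qed.

Lemma cell_countS n i : cell_count n (lift ord0 i) = n i.
Proof. by rewrite /cell_count liftK. Qed.

Definition atom n : set Omega :=
  \bigcap_i [set w | npoints L (cell i) w = (cell_count n i)%:R%:E].

Lemma atomP n w : atom n w <->
  (forall i, L (lp i) w = n i) /\ (forall l, l \notin fl -> L l w = 0%N).
Proof.
split=> [nw|[nw w0] i _]; last first.
  have [j ->|->] := unliftP ord0 i; rewrite /= /cell_count ?liftK ?unlift_none.
    by rewrite cellS npoints_set1 nw.
  by rewrite cell0; apply/npoints0 => l /= /negP; exact: w0.
split=> [i|].
  have := nw (lift ord0 i) I; rewrite /= cellS npoints_set1 /cell_count liftK.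
  by move=> [] /eqP; rewrite eqr_nat => /eqP.
have := nw ord0 I; rewrite /= cell0 /cell_count unlift_none => /npoints0 H l /negP.
exact: H.
Qed.

Lemma measurable_atom n : measurable (atom n).
Proof. by apply: fin_bigcap_measurable => // i _; exact: measurable_npoints. Qed.

(** The cells are independent, and the exponents of their Poisson laws add up to
    the total mass. *)
Lemma prob_atom n : Pr (atom n) =
  (expR (- (alpha * M)) * \prod_i ((alpha * loop_weight P (lp i)) ^+ n i / (n i)`!%:R))%:E.
Proof.
have [_ indep] := L_poisson.
rewrite /atom indep => [|//|i]; first last.
- by rewrite loop_measureE -EFinM ltry.
- exact: trivIset_cell.
rewrite big_ord_recl prob_npoints cell0 cell_count0 expr0 divr1 mul1r.
rewrite (eq_bigr (fun i => ((alpha * loop_weight P (lp i)) ^+ n i / (n i)`!%:R *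
    expR (- (alpha * loop_weight P (lp i))))%:E)) => [|i _]; last first.
  by rewrite cellS cell_countS prob_npoints /mass /loop_measure esum_set1.
rewrite prodEFin -EFinM; congr EFin; rewrite big_split /= mulrCA [RHS]mulrC.
congr (_ * _); rewrite -(big_morph _ (@expRD R) (@expR0 R)) -expRD; congr expR.
by rewrite sumrN -mulr_sumr -opprD -mulrDr -mass_split.
Qed.

Lemma atom_disjoint n n' w : atom n w -> atom n' w -> n = n'.
Proof.
move=> /atomP[nw _] /atomP[nw' _]; apply/ffunP => i; apply/val_inj.
by rewrite /= -nw -nw'.
Qed.

Lemma esum_supported (f : loop X -> nat) : (forall l, l \notin fl -> f l = 0%N) ->
  \esum_(l in [set: loop X]) (f l)%:R%:E = (\sum_i f (lp i))%:R%:E :> \bar R.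
Proof.
move=> f0; transitivity (\esum_(l in [set` fl]) (f l)%:R%:E : \bar R).
  rewrite [RHS]esum_mkcond; apply: eq_esum => l _.
  by case: ifPn => //; rewrite notin_setE => /negP lfl; rewrite f0.
rewrite esum_seq ?uniq_loops_up_to//.
by rewrite sumEFin natr_sum (big_tnth _ _ fl).
Qed.

Context (e : rel X) (k : X -> X -> nat).
Hypothesis ke : network e k.
Hypothesis K_total : (\sum_x outdeg k x <= K)%N.

Definition jumping_event : set Omega :=
  [set w | forall x y, jumping_number L x y w = (k x y)%:R%:E].

Lemma measurable_jumping_event : measurable jumping_event.
Proof.
rewrite (_ : jumping_event = \bigcap_(p in [set: X * X])
    [set w | jumping_number L p.1 p.2 w = (k p.1 p.2)%:R%:E]).
  by apply: fin_bigcap_measurable => // p _; exact: measurable_jumping.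
apply/seteqP; split => [w wk [x y] _|w wk x y]; first exact: wk.
exact: wk (x, y) I.
Qed.

Let k_diag x : k x x = 0%N. Proof. by apply: ke; left. Qed.

Lemma config_flow_jumps n x y :
  config_flow (@loop_flow X K) n (x, y) = (\sum_i n i * loop_jumps (lp i) x y)%N%:Z.
Proof.
rewrite sum_ffunE (big_morph Posz PoszD erefl); apply: eq_bigr => i _.
by rewrite ffunMnE flow_of_steps_jumps -mulr_natr natz PoszM mulrC.
Qed.

Lemma atom_jumping n w : config_flow (@loop_flow X K) n = flow_of_network k ->
  atom n w -> jumping_event w /\ npoints L diagonal_loops w = 0%E.
Proof.
move=> nk /atomP[nw w0].
have nE x y : (\sum_i n i * loop_jumps (lp i) x y)%N = k x y.
  by apply/eqP; rewrite -eqz_nat -config_flow_jumps nk ffunE.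
split=> [x y|].
  rewrite /jumping_number; case: eqP => [->|_]; first by rewrite k_diag.
  rewrite esum_supported => [|l lfl]; last by rewrite w0.
  by under eq_bigr do rewrite nw; rewrite nE.
apply/npoints0 => l [x lx]; have [lfl|] := boolP (l \in fl); last exact: w0.
have [i li] : exists i, lp i = l.
  by have /seq_tnthP[i ->] := lfl; exists i.
have /eqP := nE x x; rewrite k_diag sum_nat_eq0 => /forallP/(_ i)/=.
by rewrite muln_eq0 -nw li => /orP[/eqP//|]; rewrite eqn0Ngt lx.
Qed.

(** Without diagonal loops, the loops present only make steps counted by [k], so
    that both their sizes and their multiplicities are at most [K]. *)
Lemma jumping_atom w : jumping_event w -> npoints L diagonal_loops w = 0%E ->
  exists2 n, config_flow (@loop_flow X K) n = flow_of_network k & atom n w.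
Proof.
move=> wk /npoints0 wD.
have diag l x : (L l w * loop_jumps l x x)%N = 0%N.
  have [->|lx] := posnP (loop_jumps l x x); first by rewrite muln0.
  by rewrite wD//; exists x.
have le_k l x y : (L l w * loop_jumps l x y <= k x y)%N.
  have [<-|xy] := eqVneq x y; first by rewrite diag.
  have := wk x y; rewrite /jumping_number (negPf xy) => E.
  have := @le_esum_term R _ setT (fun l => (L l w * loop_jumps l x y)%:R%:E) l I.
  by rewrite E !lee_fin ler0n ler_nat => /(_ isT).
have size_le l : (L l w * size (loop_word l) <= K)%N.
  apply: leq_trans K_total; rewrite -lez_nat -flow_total_network.
  rewrite -size_steps PoszM -flow_total_flow_of /flow_total mulr_sumr.
  apply: ler_sum => -[x y] _; rewrite flow_of_steps_jumps ffunE -PoszM lez_nat.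
  exact: le_k.
have supp l : l \notin fl -> L l w = 0%N.
  rewrite mem_loops_up_to -leqNgt => lK; apply/eqP; rewrite -leqn0 leqNgt.
  apply/negP => Lw; have := size_le l; rewrite leqNgt => /negP; apply.
  by apply: leq_trans (leq_pmull _ Lw); rewrite (leq_trans _ lK)// ltnW.
pose n : {ffun 'I_(size fl) -> 'I_K.+1} := [ffun i => inord (L (lp i) w)].
have nE i : n i = L (lp i) w :> nat.
  rewrite ffunE inordK// ltnS; apply: leq_trans (size_le (lp i)).
  by rewrite leq_pmulr// (leq_trans _ (loop_word_size _)).
exists n; last by apply/atomP; split.
apply/ffunP => -[x y]; rewrite config_flow_jumps ffunE /=; congr Posz.
under eq_bigr do rewrite nE.
have [<-|xy] := eqVneq x y.
  by rewrite k_diag big1.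
have := wk x y; rewrite /jumping_number (negPf xy) esum_supported => [|l lfl]; last first.
  by rewrite supp.
by move=> [] /eqP; rewrite eqr_nat => /eqP.
Qed.

(** Up to the null event that a diagonal loop occurs, the event is the disjoint
    union of the atoms with flow [k]. *)
Lemma prob_jumping_event :
  Pr jumping_event = (\sum_(n : {ffun 'I_(size fl) -> 'I_K.+1} |
      config_flow (@loop_flow X K) n == flow_of_network k)
     expR (- (alpha * M)) *
     \prod_i ((alpha * loop_weight P (lp i)) ^+ n i / (n i)`!%:R))%:E.
Proof.
pose G := [set w | npoints L diagonal_loops w = 0%:R%:E].
have mE := measurable_jumping_event; have mG : measurable G := measurable_npoints _ _.
have G1 : Pr G = 1%E.
  by rewrite prob_npoints mass_diagonal mulr0 oppr0 expR0 expr0 divr1 mulr1.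
have -> : Pr jumping_event = Pr (jumping_event `&` G).
  rewrite (measureDI Pr mE mG) -[RHS]add0e; congr (_ + _)%E.
  apply/eqP; rewrite eq_le measure_ge0 andbT.
  have <- : Pr (~` G) = 0%E by rewrite probability_setC// G1 subee.
  by apply: le_measure; rewrite ?inE; [exact: measurableD|exact: measurableC|exact: subDsetr].
pose r := enum [pred n : {ffun 'I_(size fl) -> 'I_K.+1} |
  config_flow (@loop_flow X K) n == flow_of_network k].
have -> : jumping_event `&` G = \bigcup_(n in [set` r]) atom n.
  apply/seteqP; split => [w [wk wG]|w [n /=]].
    have [n nk nw] := jumping_atom wk wG.
    by exists n => //=; rewrite mem_enum inE; apply/eqP.
  by rewrite mem_enum inE => /eqP nk nw; exact: atom_jumping nk nw.
rewrite measure_fin_bigcup//; first last.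
- by move=> n _; exact: measurable_atom.
- by move=> n n' _ _ [w [nw nw']]; exact: atom_disjoint nw nw'.
rewrite -fsbig_seq ?enum_uniq//= big_enum /= -sumEFin.
by apply: eq_bigr => n _; rewrite prob_atom.
Qed.

(** The steps of a configuration with flow [k] give the monomial of [k]. *)
Lemma prod_loop_weight n : config_flow (@loop_flow X K) n = flow_of_network k ->
  \prod_i ((alpha * loop_weight P (lp i)) ^+ n i / (n i)`!%:R) =
  config_weight (@loop_rate X R alpha K) n * \prod_x \prod_y P x y ^+ k x y.
Proof.
move=> nk; have -> : \prod_x \prod_y P x y ^+ k x y =
    \prod_i steps_weight P (steps (loop_word (lp i))) ^+ n i.
  rewrite pair_big /=.
  have stepsE l :
      steps_weight P (steps (loop_word l)) = \prod_p P p.1 p.2 ^+ loop_jumps l p.1 p.2.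
    rewrite steps_weight_count; apply: eq_bigr => -[x y] _.
    by rewrite /loop_jumps /jumps.
  under [RHS]eq_bigr do rewrite stepsE -prodrXl.
  rewrite exchange_big /=; apply: eq_bigr => -[x y] _ /=.
  have := congr1 (fun f : flow X => f (x, y)) nk.
  rewrite config_flow_jumps ffunE => -[<-]; rewrite expr_sum.
  by apply: eq_bigr => i _; rewrite mulnC exprM.
rewrite /config_weight -big_split; apply: eq_bigr => i _ /=.
rewrite /loop_weight /based_weight -/(steps_weight _ _) /loop_rate -/(lp i) -/(loop_word _).
by rewrite mulrAC -exprMn mulrAC -mulrA.
Qed.

Lemma prob_jumping_network :
  Pr jumping_event = (expR (- (alpha * M)) *
    config_sum K (@loop_flow X K) (@loop_rate X R alpha K) (flow_of_network k) *
    \prod_x \prod_y P x y ^+ k x y)%:E.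
Proof.
rewrite prob_jumping_event -mulr_sumr /config_sum; congr EFin.
rewrite -mulrA; congr (_ * _); rewrite mulr_suml; apply: eq_bigr => n /eqP.
exact: prod_loop_weight.
Qed.

End PoissonCells.

(** * The law of the jumping numbers *)

Theorem proposition4p1 (R : realType) (X : finType) (e : rel X)
  (e_sym : symmetric e) (e_irr : irreflexive e)
  (C : X -> X -> R) (kappa : X -> R)
  (C_sym : forall x y, C x y = C y x)
  (C_ge0 : forall x y, 0 <= C x y)
  (C_edge : forall x y, ~~ e x y -> C x y = 0)
  (kappa_ge0 : forall x, 0 <= kappa x)
  (energy_pos : positive_definite_energy C kappa) :
  let P := transition C kappa in
  (forall (alpha : R) (d : measure_display) (Omega : measurableType d)
     (Pr : probability Omega R) (L : loop X -> {RV Pr >-> nat}),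
     0 < alpha -> loop_ensemble P alpha L ->
     forall k : X -> X -> nat, eulerian e k ->
     Pr [set w | forall x y, jumping_number L x y w = (k x y)%:R%:E]
     = ((per_coef e alpha k / (\prod_x (outdeg k x)`!)%:R)
        * (\det (1%:M - mx_of P)) `^ alpha
        * \prod_x \prod_y P x y ^+ k x y)%:E)
  /\
  (forall (d : measure_display) (Omega : measurableType d)
     (Pr : probability Omega R) (L : loop X -> {RV Pr >-> nat}),
     loop_ensemble P 1 L ->
     forall k : X -> X -> nat, eulerian e k ->
     Pr [set w | forall x y, jumping_number L x y w = (k x y)%:R%:E]
     = (\det (1%:M - mx_of P)
        * ((\prod_x (outdeg k x)`!)%:R / (\prod_x \prod_y (k x y)`!)%:R)
        * \prod_x \prod_y P x y ^+ k x y)%:E).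
Proof.
move=> P.
have C_diag x : C x x = 0 by rewrite C_edge// e_irr.
have P_ge0 x y : 0 <= P x y by exact: transition_ge0.
have P_diag x : P x x = 0 by rewrite /P /transition C_diag mul0r.
have [h [r [r_ge0 r_lt1 h_ge1 Ph]]] := superharmonic C_sym C_ge0 C_diag energy_pos.
have [M total_mass detE] := total_loop_mass P_ge0 P_diag r_ge0 r_lt1 h_ge1 Ph.
have fact_neq0 (k : X -> X -> nat) : (\prod_x (outdeg k x)`!)%:R != 0 :> R.
  by rewrite pnatr_eq0 -lt0n prodn_gt0// => x; exact: fact_gt0.
have part1 (alpha : R) (d : measure_display) (Omega : measurableType d)
    (Pr : probability Omega R) (L : loop X -> {RV Pr >-> nat}) :
    0 < alpha -> loop_ensemble P alpha L ->
    forall k : X -> X -> nat, eulerian e k ->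
    Pr [set w | forall x y, jumping_number L x y w = (k x y)%:R%:E]
    = ((per_coef e alpha k / (\prod_x (outdeg k x)`!)%:R)
       * (\det (1%:M - mx_of P)) `^ alpha
       * \prod_x \prod_y P x y ^+ k x y)%:E.
  move=> alpha_gt0 ensL k [ke _]; rewrite detE -expRM mulNr [M * _]mulrC.
  rewrite per_coef_loops ?gt_eqF// [_ * _ / _]mulrAC divff// mul1r [_ * expR _]mulrC.
  exact: (prob_jumping_network P_ge0 P_diag alpha_gt0 total_mass ensL ke).
split=> // d Omega Pr L ensL k ke.
rewrite (part1 1 d Omega Pr L)//; congr (_ * _)%:E.
rewrite powRr1 ?detE ?expR_ge0// mulrC; congr (_ * _).
have kfact : (\prod_x \prod_y (k x y)`!)%:R != 0 :> R.
  rewrite pnatr_eq0 -lt0n prodn_gt0// => x; rewrite prodn_gt0// => y.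
  exact: fact_gt0.
apply: (mulIf (fact_neq0 k)); rewrite divfK//; apply: (mulIf kfact).
by rewrite per_coef1// mulrAC divfK// expr2.
Qed.
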